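(* The map $$\operatorname{Der}_+^\zeta(\overline{\mathsf A}_\bullet)\longrightarrow D_+^0,\qquad(d_i)_{i\ge0}\longmapsto d_0,$$ is (well-defined and) an isomorphism.
   Context: Setting: $V$ is an oriented handlebody of genus $g\ge1$, $D\subset\partial V$ a closed disk, $\Sigma:=\partial V\setminus\operatorname{int}(D)$, $\star\in\partial\Sigma$, $\pi:=\pi_1(\Sigma,\star)$, $F:=\pi_1(V,\star)$, $\varpi:\pi\to F$ induced by inclusion, $\mathsf A:=\ker\varpi$, $\mathbb A:=\mathsf A/[\mathsf A,\mathsf A]$ (a left $\mathbb Z[F]$-module by conjugation, ${}^{\varpi(x)}[a]=[xax^{-1}]$), $\zeta\in\mathsf A$ the class of $\partial\Sigma$. Let $\overline{\mathsf A}_\bullet$ be the extended graded Lie algebra consisting of the group $\overline{\mathsf A}_0=F$ acting on the graded Lie algebra $\overline{\mathsf A}_+=\bigoplus_{m\ge1}\Gamma_m\mathsf A/\Gamma_{m+1}\mathsf A=\operatorname{Lie}(\mathbb A)$ (free Lie algebra). Fix a basis $(\alpha_i,\beta_i)_{1\le i\le g}$ of $\pi$ given by meridians $\alpha_i$ and parallels $\beta_i$: $\mathsf A$ is normally generated by the $\alpha_i$, $x_i:=\varpi(\beta_i)$ form a basis of $F$, $a_i:=[\alpha_i]$ form a $\mathbb Z[F]$-basis of $\mathbb A$, $\zeta^{-1}=\prod_{i=1}^g[\beta_i^{-1},\alpha_i]$; hence $[\zeta]=\sum_i(1-x_i^{-1})\cdot a_i$. Derivations: for $m\ge1$, a derivation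 of degree $m$ of $\overline{\mathsf A}_\bullet$ is a family $(d_i)_{i\ge0}$ of maps $d_i:\overline{\mathsf A}_i\to\overline{\mathsf A}_{m+i}$ such that $(d_i)_{i\ge1}$ is a derivation of the graded Lie algebra $\overline{\mathsf A}_+$, $d_0$ is a 1-cocycle ($d_0(ab)=d_0(a)+{}^ad_0(b)$), and $d_i({}^fb)={}^f(d_i(b))+[d_0(f),{}^fb]$ for $f\in F$, $b\in\overline{\mathsf A}_i$, $i\ge1$. $\operatorname{Der}_+^\zeta(\overline{\mathsf A}_\bullet)$ is the direct sum over $m\ge1$ of the groups of those derivations of degree $m$ with $d_1([\zeta])=0$. The group $D_+^0$: let $\mathbb A^r$ be $\mathbb A$ with the right $\mathbb Z[F]$-action $a\cdot f={}^{f^{-1}}a$. Let $\langle-,-\rangle:\mathbb Z[F]\times\mathbb A\to\mathbb Z[F]$ be the pairing induced by the homotopy intersection form of $\Sigma$: the unique $\mathbb Z$-bilinear map with $\langle xy,a\rangle=x\langle y,a\rangle+\langle x,a\rangle\varepsilon(y)$, $\langle x,{}^fa\rangle=\langle x,a\rangle f^{-1}$ ($f\in F$), $\langle x_i,a_j\rangle=-\delta_{ij}$. For any left $\mathbb Z[F]$-module $M$ there is an isomorphism $\vartheta:Z^1(F,M)\to\mathbb A^r\otimes_{\mathbb Z[F]}M$ whose inverse sends $u\otimes m$ to the cocycle $f\mapsto\langle f,u\rangle\cdot m$; explicitly $\vartheta(c)=-\sum_ia_i\otimes c(x_i)$. Let $\beta:\mathbb A^r\otimes_{\mathbb Z[F]}\overline{\mathsf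 A}_+\to\overline{\mathsf A}_+/I_F\overline{\mathsf A}_+$ be induced by the Lie bracket, where $I_F$ is the augmentation ideal of $\mathbb Z[F]$. Then $D_+^0:=\{c\in Z^1(F,\overline{\mathsf A}_+):\beta\vartheta(c)=0\}$. *)

(* Defs.v *)
From HB Require Import structures.
From mathcomp Require Import all_boot all_order all_algebra.
From mathcomp Require Import finmap.
From mathcomp Require Import boolp classical_sets functions.
From mathcomp.multinomials Require Import monalg.

Set Implicit Arguments.
Unset Strict Implicit.
Unset Printing Implicit Defensive.

Import GRing.Theory.

Local Open Scope classical_set_scope.

Section Subgroups.
Local Open Scope group_scope.
Variable G : groupType.
Implicit Types (H K L A S : set G) (x y z : G).

Definition subgroup_set H :=
  [/\ H 1, forall x y, H x -> H y -> H (x * y) & forall x, H x -> H x^-1].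

Definition normal_set H :=
  subgroup_set H /\ forall x y, H x -> H (x ^ y).

Definition commutator_set H K : set G :=
  smallest subgroup_set [set [~ x, y] | x in H & y in K].

(* Gamma_1 A = A and Gamma_(n+1) A = [Gamma_n A, A] for n >= 1. It is
   convenient to put Gamma_0 A := A as well, so that Gamma_0 / Gamma_1 is
   trivial. *)
Definition lcs A (n : nat) : set G := iter n.-1 (commutator_set^~ A) A.

Lemma subgroup_set_smallest S : subgroup_set (smallest subgroup_set S).
Proof.
split=> [|x y Hx Hy|x Hx] X CX; move: (CX) => [[X1 XM XV] SX] //.
- exact: XM (Hx _ CX) (Hy _ CX).
- exact: XV (Hx _ CX).
Qed.

Lemma commutator_set_mem H K x y :
  H x -> K y -> commutator_set H K [~ x, y].
Proof. by move=> Hx Ky; apply: sub_gen_smallest; exists x => //; exists y. Qed.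

Lemma normal_commutator_set H K :
  normal_set H -> normal_set K -> normal_set (commutator_set H K).
Proof.
move=> [_ nH] [_ nK]; split; first exact: subgroup_set_smallest.
move=> x y Cx; have [C1 CM CV] := subgroup_set_smallest
  [set [~ x, y] | x in H & y in K].
suff: commutator_set H K `<=` [set z | commutator_set H K (z ^ y)] by apply.
apply: smallest_sub => [|_ [u Hu [v Kv <-]]] /=.
  split=> /= [|u v|u]; rewrite ?conj1g ?conjMg ?conjVg //.
  - exact: CM.
  - exact: CV.
by rewrite conjRg; apply: commutator_set_mem; [apply: nH|apply: nK].
Qed.

Lemma commutator_set_sub H K L : subgroup_set L ->
  (forall x y, H x -> K y -> L [~ x, y]) -> commutator_set H K `<=` L.
Proof.
by move=> sL HKL; apply: smallest_sub => // _ [x Hx [y Ky <-]]; apply: HKL.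
Qed.

Lemma normal_comm_r H x y : normal_set H -> H x -> H [~ x, y].
Proof.
move=> [[_ HM HV] nH] Hx; rewrite commgEl; apply: HM; first exact: HV.
exact: nH.
Qed.

Lemma normal_comm_l H x y : normal_set H -> H y -> H [~ x, y].
Proof.
move=> nH Hy; rewrite -invgR; case: (nH) => [[_ _ HV] _].
apply: HV; exact: normal_comm_r.
Qed.

Lemma commg_mulr x y z : [~ x, y * z] = [~ x, z] * [~ x, y] ^ z.
Proof. by rewrite /commg /conjg !gnorm. Qed.

Lemma lcsS A n : lcs A n.+2 = commutator_set (lcs A n.+1) A.
Proof. by []. Qed.

Section LCS.
Variable A : set G.
Hypothesis nA : normal_set A.

Lemma normal_lcs n : normal_set (lcs A n).
Proof.
rewrite /lcs; elim: n.-1 => //= k IHk; exact: normal_commutator_set.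
Qed.

Lemma lcs_sub n : lcs A n.+1 `<=` lcs A n.
Proof.
case: n => [|n] //; rewrite lcsS; apply: commutator_set_sub.
  by case: (normal_lcs n.+1).
by move=> x y Hx _; apply: normal_comm_r => //; apply: normal_lcs.
Qed.

Lemma lcs_subA n : lcs A n `<=` A.
Proof. by elim: n => // n IHn x /lcs_sub /IHn. Qed.

Lemma hall_witt x y z :
  [~ x, y^-1, z] ^ y * [~ y, z^-1, x] ^ z * [~ z, x^-1, y] ^ x = 1.
Proof.
by rewrite /commg /conjg !gnorm.
Qed.

Lemma three_subgroups H K L N : normal_set N ->
  normal_set H -> normal_set K -> normal_set L ->
  (forall x y z, K x -> L y -> H z -> N [~ x, y, z]) ->
  (forall x y z, L x -> H y -> K z -> N [~ x, y, z]) ->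
  forall x y z, H x -> K y -> L z -> N [~ x, y, z].
Proof.
move=> nN nH nK nL NKLH NLHK x y z Hx Ky Lz.
case: (nN) => [[_ NM NV] NJ].
have gV (M : set G) u : normal_set M -> M u -> M u^-1.
  by move=> [[_ _ MV] _]; apply: MV.
have := hall_witt x y^-1 z; rewrite invgK -mulgA => /eqP; rewrite mulg_eq1 => /eqP.
set a := [~ y^-1, z^-1, x]; set b := [~ z, x^-1, y^-1].
have Na : N a by apply: NKLH => //; apply: gV.
have Nb : N b by apply: NLHK => //; apply: gV.
move=> /(congr1 (fun t => t ^ y)); rewrite conjgKV => ->.
by apply/(NJ)/NV/NM; apply: (NJ).
Qed.

Lemma lcs_comm m n x y : lcs A m x -> lcs A n y -> lcs A (m + n) [~ x, y].
Proof.
have nL := normal_lcs.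
case: m => [|m]; first by move=> _ Ly; apply: normal_comm_l => //; apply: nL.
case: n => [|n]; first by move=> Lx _; rewrite addn0; apply: normal_comm_r.
elim: n m x y => [|n IHn] m x y Lx.
  by rewrite addn1 => Ly; apply: commutator_set_mem.
suff sub : lcs A n.+2 `<=` [set y | forall x, lcs A m.+1 x ->
    lcs A (m.+1 + n.+2) [~ x, y]] by move=> /sub; apply.
case: (nL (m.+1 + n.+2)%N) => [[L1 LM LV] LJ].
rewrite lcsS; apply: commutator_set_sub => [|u v Lu Av].
  split=> [t Lt|u v Hu Hv t Lt|u Hu t Lt].
  - by rewrite commg1.
  - by rewrite commg_mulr; apply: LM; [apply: Hv|apply/LJ/Hu].
  - have -> : [~ t, u^-1] = ([~ t, u] ^ u^-1)^-1.
      by rewrite /commg /conjg !gnorm.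
    by apply/LV/LJ/Hu.
move=> t Lt; rewrite -invgR; apply: LV.
apply: (@three_subgroups (lcs A n.+1) A (lcs A m.+1)) => // [a b c Aa Lb Lc|a b c La Lb Ac].
- rewrite -[n.+2]addn1 addnA addn1 addSnnS addnC.
  rewrite addnC; have -> : (m + n.+2)%N.+1 = (m.+2 + n.+1)%N by rewrite addSnnS addSn.
  apply: IHn => //; rewrite -invgR lcsS.
  case: (nL m.+2) => [[_ _ h] _]; apply: h; exact: commutator_set_mem.
- have -> : (m.+1 + n.+2 = (m.+1 + n.+1).+1)%N by rewrite addnS.
  by rewrite [(m.+1 + _)%N]addSn lcsS -addSn; apply: commutator_set_mem => //; apply: IHn.
Qed.

End LCS.
End Subgroups.

(* A subgroup K of a subgroup H, with H / K abelian. *)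
Record section_data (G : groupType) := SectionData {
  sec_top : set G;
  sec_bot : set G;
  sec_topP : subgroup_set sec_top;
  sec_botP : subgroup_set sec_bot;
  sec_sub : sec_bot `<=` sec_top;
  sec_comm : forall x y, sec_top x -> sec_top y -> sec_bot [~ x, y]%g
}.

Section AbelianSection.
Local Open Scope group_scope.
Local Open Scope quotient_scope.
Variables (G : groupType) (Q : section_data G).
Local Notation H := (sec_top Q).
Local Notation K := (sec_bot Q).
Implicit Types x y z : G.

Let H1 : H 1. Proof. by case: (sec_topP Q). Qed.
Let HM x y : H x -> H y -> H (x * y).
Proof. by case: (sec_topP Q) => _ + _; apply. Qed.
Let HV x : H x -> H x^-1. Proof. by case: (sec_topP Q) => _ _; apply. Qed.
Let K1 : K 1. Proof. by case: (sec_botP Q). Qed.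
Let KM x y : K x -> K y -> K (x * y).
Proof. by case: (sec_botP Q) => _ + _; apply. Qed.
Let KV x : K x -> K x^-1. Proof. by case: (sec_botP Q) => _ _; apply. Qed.

Definition sec_rel (x y : set_type H) : bool := `[< K ((val x)^-1 * val y) >].

Lemma sec_rel_equiv : equiv_class_of sec_rel.
Proof.
split=> [x|x y|y x z]; rewrite /sec_rel.
- by apply/asboolP; rewrite mulVg.
- by apply/asbool_equiv_eq; split=> /KV; rewrite invgM invgK.
- move=> /asboolP h1 /asboolP h2; apply/asboolP.
  by have := KM h1 h2; rewrite mulgA mulgK.
Qed.
Canonical sec_rel_canonical := EquivRelPack sec_rel_equiv.

Definition sec_quot := {eq_quot sec_rel}.
HB.instance Definition _ := Choice.on sec_quot.

(* The class of x in H / K (by convention, the class of 1 when x is not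
   in H). *)
Definition sec_class x : sec_quot :=
  match pselect (H x) with
  | left Hx => \pi_sec_quot (SigSub (mem_set Hx))
  | right _ => \pi_sec_quot (SigSub (mem_set H1))
  end.

Definition sec_repr (a : sec_quot) : G := val (repr a).

Lemma sec_reprP a : H (sec_repr a).
Proof. exact: set_valP (repr a). Qed.

Lemma sec_reprK a : sec_class (sec_repr a) = a.
Proof.
rewrite /sec_class; case: pselect => [Hx|/(_ (sec_reprP a))//].
by rewrite -[RHS]reprK; congr (\pi_sec_quot _); apply: val_inj.
Qed.

Lemma sec_classP x y : H x -> H y ->
  sec_class x = sec_class y <-> K (x^-1 * y).
Proof.
move=> Hx Hy; rewrite /sec_class.
case: pselect => // Hx'; case: pselect => // Hy'.
split=> [/eqP|Kxy].
  by rewrite piE /sec_rel /= => /asboolP.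
by apply/eqP; rewrite piE; apply/asboolP.
Qed.

Definition sec_add a b := sec_class (sec_repr a * sec_repr b).
Definition sec_opp a := sec_class (sec_repr a)^-1.

Lemma sec_class_mod x k : H x -> K k -> sec_class (x * k) = sec_class x.
Proof.
move=> Hx Kk; have Hk := sec_sub Kk; apply/sec_classP => //; first exact: HM.
by rewrite invgM mulgVK; apply: (KV).
Qed.

Lemma sec_class_repr x : H x -> exists2 k, K k & sec_repr (sec_class x) = x * k.
Proof.
move=> Hx; exists (x^-1 * sec_repr (sec_class x)); last by rewrite mulgA mulgV mul1g.
by apply/sec_classP => //; [exact: sec_reprP|rewrite sec_reprK].
Qed.

Lemma sec_classM x y : H x -> H y ->
  sec_class (x * y) = sec_add (sec_class x) (sec_class y).
Proof.
move=> Hx Hy; rewrite /sec_add.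
have [k Kk ->] := sec_class_repr Hx; have [l Kl ->] := sec_class_repr Hy.
have Hk := sec_sub Kk.
have -> : x * k * (y * l) = x * y * (k * [~ k, y] * l).
  by rewrite /commg /conjg !gnorm.
rewrite [RHS]sec_class_mod //; first exact: HM.
by apply: (KM) => //; apply: (KM) => //; exact: sec_comm.
Qed.

Lemma sec_addA : associative sec_add.
Proof.
move=> a b c; rewrite -[a]sec_reprK -[b]sec_reprK -[c]sec_reprK.
have := sec_reprP; move=> Hr.
by rewrite -!sec_classM ?mulgA //; do ?(apply: (HM) => //).
Qed.

Lemma sec_addC : commutative sec_add.
Proof.
move=> a b; rewrite /sec_add.
apply/sec_classP; try by apply: (HM); exact: sec_reprP.
have -> (u v : G) : (u * v)^-1 * (v * u) = [~ v, u] by rewrite /commg /conjg !gnorm.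
by apply: sec_comm; exact: sec_reprP.
Qed.

Lemma sec_add0 : left_id (sec_class 1) sec_add.
Proof.
move=> a; rewrite -[a]sec_reprK -sec_classM ?mul1g //; exact: sec_reprP.
Qed.

Lemma sec_addN : left_inverse (sec_class 1) sec_opp sec_add.
Proof.
move=> a; rewrite -{2}[a]sec_reprK /sec_opp -sec_classM ?mulVg //.
  by apply: (HV); exact: sec_reprP.
exact: sec_reprP.
Qed.

HB.instance Definition _ :=
  GRing.isZmodule.Build sec_quot sec_addA sec_addC sec_add0 sec_addN.

End AbelianSection.

Local Open Scope ring_scope.

Section FreeAbelian.
Variables (X : choiceType) (V : zmodType).

(* The additive extension of h : X -> V to Z[X]. *)
Definition zlift (h : X -> V) (s : {malg int[X]}) : V :=
  \sum_(x <- msupp s) h x *~ s@_x.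

Lemma zliftEw h (s : {malg int[X]}) (D : {fset X}) : {subset msupp s <= D} ->
  zlift h s = \sum_(x <- D) h x *~ s@_x.
Proof.
move=> /fsubsetP sD; apply: big_fset_incl => // x _ xs.
by rewrite mcoeff_outdom // mulr0z.
Qed.

Lemma zlift_is_additive h : zmod_morphism (zlift h).
Proof.
move=> s t; pose D := (msupp s `|` msupp t `|` msupp (s - t))%fset.
have sub (u : {malg int[X]}) : (msupp u `<=` D)%fset -> zlift h u = \sum_(x <- D) h x *~ u@_x.
  by move=> /fsubsetP; apply: zliftEw.
rewrite !sub; try by apply/fsubsetP => x; rewrite !inE => ->; rewrite ?orbT.
by rewrite -sumrB; apply: eq_bigr => x _; rewrite mcoeffB mulrzBr.
Qed.

HB.instance Definition _ h :=
  GRing.isZmodMorphism.Build {malg int[X]} V (zlift h) (zlift_is_additive h).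

Lemma zliftU h x : zlift h << x >> = h x.
Proof.
rewrite (@zliftEw _ _ [fset x]%fset); last by apply/fsubsetP/msuppU_le.
by rewrite big_seq_fset1 mcoeffUU.
Qed.

End FreeAbelian.

Lemma malg_ind (X : choiceType) (P : {malg int[X]} -> Prop) :
  P 0 -> (forall x, P << x >>) -> (forall s t, P s -> P t -> P (s - t)) ->
  forall s, P s.
Proof.
move=> P0 PU PB s.
have PN t : P t -> P (- t) by move=> Pt; rewrite -sub0r; apply: PB.
have PD t u : P t -> P u -> P (t + u).
  by move=> Pt Pu; rewrite -[u]opprK; apply: PB => //; apply: PN.
have PM t n : P t -> P (t *+ n).
  by move=> Pt; elim: n => [|n IHn]; rewrite ?mulr0n // mulrS; apply: PD.
rewrite [s]monalgE; apply: big_ind => // x _.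
have -> : << s@_x *g x >> = << x >> *~ s@_x.
  by apply/malgP => y; rewrite raddfMz /= !mcoeffU -mulrzl intz mulrnAr mulr1.
by case: (s@_x) => n; [exact: PM|apply/PN/PM].
Qed.

Lemma zlift_sub (X : choiceType) (V : zmodType) (h k : X -> V) s :
  zlift (fun x => h x - k x) s = zlift h s - zlift k s.
Proof. by rewrite /zlift -sumrB; apply: eq_bigr => x _; rewrite mulrzBl. Qed.

Lemma zlift_sub2 (X : choiceType) (V : zmodType) (h : X -> V) x y :
  zlift h (<< x >> - << y >>) = h x - h y.
Proof. by rewrite raddfB /= !zliftU. Qed.

Lemma zlift_sub3 (X : choiceType) (V : zmodType) (h : X -> V) x y z :
  zlift h (<< x >> - << y >> - << z >>) = h x - h y - h z.
Proof. by rewrite !raddfB /= !zliftU. Qed.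

Definition group_ring (F : groupType) : Type := {malg int[F]}.
HB.instance Definition _ F := GRing.Zmodule.on (group_ring F).

Section GroupRing.
Variable F : groupType.
Implicit Types (f h : F) (s t u : group_ring F).

Definition of_group f : group_ring F := << f >>.

Definition group_ring_mul s t : group_ring F :=
  zlift (fun f => zlift (fun h => of_group (f * h)%g) t) s.

Local Notation "s *' t" := (group_ring_mul s t) (at level 40).

Lemma group_ring_mulBl s t u : (s - t) *' u = s *' u - t *' u.
Proof. exact: raddfB. Qed.

Lemma group_ring_mulBr s t u : s *' (t - u) = s *' t - s *' u.
Proof.
rewrite -zlift_sub; congr (zlift _ s); apply/funext => f; exact: raddfB.
Qed.

Lemma of_group_mul f h : of_group f *' of_group h = of_group (f * h)%g.
Proof. by rewrite /group_ring_mul !zliftU. Qed.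

Lemma group_ring_mul0l s : 0 *' s = 0.
Proof. exact: raddf0. Qed.

Lemma group_ring_mul0r s : s *' 0 = 0.
Proof. by rewrite -[X in s *' X](subrr 0) group_ring_mulBr subrr. Qed.

Lemma group_ring_mulA : associative group_ring_mul.
Proof.
move=> s t u; elim/malg_ind: s => [|f|s s' IHs IHs'].
- by rewrite !group_ring_mul0l.
- elim/malg_ind: t => [|h|t t' IHt IHt'].
  + by rewrite group_ring_mul0l !group_ring_mul0r group_ring_mul0l.
  + elim/malg_ind: u => [|k|u u' IHu IHu'].
    * by rewrite !group_ring_mul0r.
    * by rewrite !of_group_mul mulgA.
    * by rewrite !group_ring_mulBr IHu IHu'.
  + by rewrite group_ring_mulBl !group_ring_mulBr group_ring_mulBl IHt IHt'.
- by rewrite !group_ring_mulBl IHs IHs'.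
Qed.

Lemma group_ring_mul1l : left_id (of_group 1%g) group_ring_mul.
Proof.
move=> s; elim/malg_ind: s => [|f|s t IHs IHt].
- exact: group_ring_mul0r.
- by rewrite of_group_mul mul1g.
- by rewrite group_ring_mulBr IHs IHt.
Qed.

Lemma group_ring_mul1r : right_id (of_group 1%g) group_ring_mul.
Proof.
move=> s; elim/malg_ind: s => [|f|s t IHs IHt].
- exact: group_ring_mul0l.
- by rewrite of_group_mul mulg1.
- by rewrite group_ring_mulBl IHs IHt.
Qed.

Lemma group_ring_mulDl : left_distributive group_ring_mul +%R.
Proof. by move=> s t u; exact: raddfD. Qed.

Lemma group_ring_mulDr : right_distributive group_ring_mul +%R.
Proof.
move=> s t u; rewrite -[u]opprK group_ring_mulBr -[- u]sub0r group_ring_mulBr.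
by rewrite group_ring_mul0r sub0r opprK sub0r opprK.
Qed.

Lemma of_group1_neq0 : of_group 1%g != 0.
Proof.
by apply/eqP => /malgP/(_ 1%g); rewrite mcoeffUU mcoeff0.
Qed.

HB.instance Definition _ := GRing.Zmodule_isNzRing.Build (group_ring F)
  group_ring_mulA group_ring_mul1l group_ring_mul1r
  group_ring_mulDl group_ring_mulDr of_group1_neq0.

Definition augmentation s : int := zlift (fun=> 1) s.

Definition augmentation_ideal : set (group_ring F) := [set s | augmentation s = 0].

(* The linear extension of f |-> f^-1. *)
Definition antipode s : group_ring F := zlift (fun f => of_group f^-1%g) s.

End GroupRing.

(* A Z-linear action of F on V amounts to a left Z[F]-module structure. *)
Section ActionModule.
Variables (F : groupType) (V : zmodType) (act : F -> V -> V).

Definition linear_action :=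
  [/\ forall v, act 1%g v = v,
      forall f h v, act (f * h)%g v = act f (act h v)
    & forall f, {morph act f : u v / u + v}].

Definition action_scale (s : group_ring F) (v : V) : V :=
  zlift (fun f => act f v) s.

Hypothesis actP : linear_action.

Lemma linear_action0 f : act f 0 = 0.
Proof.
by have [_ _ actD] := actP; apply: (addrI (act f 0)); rewrite -actD !addr0.
Qed.

Lemma linear_actionN f v : act f (- v) = - act f v.
Proof.
have [_ _ actD] := actP.
by apply: (addrI (act f v)); rewrite -actD !subrr linear_action0.
Qed.

Lemma action_scaleU f v : action_scale (of_group f) v = act f v.
Proof. exact: zliftU. Qed.

Lemma action_scaleBl s t v :
  action_scale (s - t) v = action_scale s v - action_scale t v.
Proof. exact: raddfB. Qed.

Lemma action_scale0l v : action_scale 0 v = 0.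
Proof. exact: raddf0. Qed.

Lemma action_scaleBr s u v :
  action_scale s (u - v) = action_scale s u - action_scale s v.
Proof.
have [_ _ actD] := actP; rewrite -zlift_sub; congr (zlift _ s).
by apply/funext => f; rewrite actD linear_actionN.
Qed.

Lemma action_scale0r s : action_scale s 0 = 0.
Proof. by rewrite -[X in action_scale s X](subrr 0) action_scaleBr subrr. Qed.

Lemma action_scaleA s t v :
  action_scale s (action_scale t v) = action_scale (s * t) v.
Proof.
have [_ actM _] := actP.
elim/malg_ind: s => [|f|s s' IHs IHs'].
- by rewrite mul0r !action_scale0l.
- elim/malg_ind: t => [|h|t t' IHt IHt'].
  + by rewrite mulr0 action_scale0l action_scale0r.
  + by rewrite [_ * _]of_group_mul !action_scaleU actM.
  + by rewrite mulrBr !action_scaleBl action_scaleBr IHt IHt'.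
- by rewrite mulrBl !action_scaleBl IHs IHs'.
Qed.

Lemma action_scale1 : left_id 1 action_scale.
Proof. by move=> v; have [act1 _ _] := actP; rewrite action_scaleU. Qed.

Lemma action_scaleDr : right_distributive action_scale +%R.
Proof.
by move=> s u v; rewrite -[v]opprK action_scaleBr -[- v]sub0r action_scaleBr
  action_scale0r sub0r opprK sub0r opprK.
Qed.

Lemma action_scaleDl v : {morph action_scale^~ v : s t / s + t}.
Proof. by move=> s t; exact: raddfD. Qed.

End ActionModule.

Section ZSpan.
Variables (V : zmodType) (S : set V).

Definition zspan : {pred V} :=
  [pred v | `[< smallest (fun W : set V => W 0 /\
      forall u v, W u -> W v -> W (u - v)) S v >]].

Lemma zspan_zmod_closed : zmod_closed zspan.
Proof.
split=> [|u v /asboolP Su /asboolP Sv]; apply/asboolP => W CW.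
  by case: (CW) => [[W0 _] _].
by case: (CW) => [[_ WB] _]; apply: WB; [exact: Su|exact: Sv].
Qed.

HB.instance Definition _ := GRing.isZmodClosed.Build V zspan zspan_zmod_closed.

End ZSpan.

Section Tensor.
(* For a ring R, a right R-module U, with right multiplication ract, and a
   left R-module M, the abelian group of U tensored with M over R. *)
Variables (R : nzRingType) (U : zmodType) (ract : U -> R -> U).
Variable M : lmodType R.

Definition pure_tensor (u : U) (m : M) : {malg int[(U * M)%type]} := << (u, m) >>.

Definition tensor_relations : set {malg int[(U * M)%type]} :=
  [set x | exists u u' m, x = pure_tensor (u + u') m - pure_tensor u m - pure_tensor u' m] `|`
  [set x | exists u m m', x = pure_tensor u (m + m') - pure_tensor u m - pure_tensor u m'] `|`
  [set x | exists u r m, x = pure_tensor (ract u r) m - pure_tensor u (r *: m)].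

Definition tensor := {ideal_quot zspan tensor_relations}.
HB.instance Definition _ := GRing.Zmodule.on tensor.

Definition tens (u : U) (m : M) : tensor := \pi_tensor%qT (pure_tensor u m).

End Tensor.

Section DirectSum.
Variable V : nat -> zmodType.

Definition finitely_supported (f : forall n, V n) :=
  exists N, forall n, (N <= n)%N -> f n = 0.

Record direct_sum := DirectSum {
  component :> forall n, V n;
  componentP : finitely_supported component
}.

HB.instance Definition _ := gen_eqMixin direct_sum.
HB.instance Definition _ := gen_choiceMixin direct_sum.

Lemma direct_sum_ext (a b : direct_sum) : (forall n, a n = b n) -> a = b.
Proof.
case: a b => [a aP] [b bP] /= ab; have eab : a = b by apply: functional_extensionality_dep.
by subst b; congr DirectSum; exact: Prop_irrelevance.
Qed.

Lemma direct_sum_zeroP : finitely_supported (fun n => 0 : V n).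
Proof. by exists 0%N. Qed.

Lemma direct_sum_addP (a b : direct_sum) : finitely_supported (fun n => a n + b n).
Proof.
have [M aM] := componentP a; have [N bN] := componentP b.
by exists (maxn M N) => n; rewrite geq_max => /andP[/aM -> /bN ->]; rewrite addr0.
Qed.

Lemma direct_sum_oppP (a : direct_sum) : finitely_supported (fun n => - a n).
Proof. by have [M aM] := componentP a; exists M => n /aM ->; rewrite oppr0. Qed.

Definition direct_sum_add a b := DirectSum (direct_sum_addP a b).

Lemma direct_sum_addA : associative direct_sum_add.
Proof. by move=> a b c; apply: direct_sum_ext => n; exact: addrA. Qed.
Lemma direct_sum_addC : commutative direct_sum_add.
Proof. by move=> a b; apply: direct_sum_ext => n; exact: addrC. Qed.
Lemma direct_sum_add0 : left_id (DirectSum direct_sum_zeroP) direct_sum_add.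
Proof. by move=> a; apply: direct_sum_ext => n; exact: add0r. Qed.
Lemma direct_sum_addN : left_inverse (DirectSum direct_sum_zeroP)
  (fun a => DirectSum (direct_sum_oppP a)) direct_sum_add.
Proof. by move=> a; apply: direct_sum_ext => n; exact: addNr. Qed.

HB.instance Definition _ := GRing.isZmodule.Build direct_sum
  direct_sum_addA direct_sum_addC direct_sum_add0 direct_sum_addN.

End DirectSum.

Definition free_basis (G : groupType) (I : Type) (e : I -> G) : Prop :=
  forall (H : groupType) (h : I -> H),
    exists! phi : G -> H,
      {morph phi : x y / (x * y)%g} /\ forall i, phi (e i) = h i.

(* The group-theoretic data of a handlebody V of genus g with a disk removed
   from its boundary: pi = pi_1(Sigma), F = pi_1(V), the map varpi induced by
   the inclusion, and a basis of pi given by meridians and parallels. *)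
Record handlebody (g : nat) := Handlebody {
  pi_ : groupType;
  F_ : groupType;
  varpi : pi_ -> F_;
  varpiM : {morph varpi : x y / (x * y)%g};
  alpha : 'I_g -> pi_;
  beta : 'I_g -> pi_;
  pi_basis : free_basis (fun s : 'I_g + 'I_g =>
    match s with inl i => alpha i | inr i => beta i end);
  F_basis : free_basis (fun i => varpi (beta i));
  (* ker varpi is the normal closure of the meridians *)
  kerP : [set x | varpi x = 1%g] = smallest (@normal_set pi_) (range alpha)
}.

Section Handlebody.
Variables (g : nat) (H : handlebody g).
Local Notation pi := (pi_ H).
Local Notation F := (F_ H).
Local Notation alpha := (@alpha g H).
Local Notation beta := (@beta g H).
Local Notation varpi := (@varpi g H).

Definition kerA : set pi := [set x | varpi x = 1%g].
Local Notation A := kerA.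

Definition x_ (i : 'I_g) : F := varpi (beta i).

(* The class of the boundary of Sigma: its inverse is the product of the
   [beta_i^-1, alpha_i], where [x, y] = x y x^-1 y^-1, i.e., [~ x^-1, y^-1] in
   the convention [~ x, y] = x^-1 y^-1 x y of the library. *)
Definition zeta : pi := ((\prod_(i < g) [~ beta i, (alpha i)^-1])^-1)%g.

Lemma varpi1 : varpi 1%g = 1%g.
Proof. by apply: (mulgI (varpi 1%g)); rewrite -varpiM !mulg1. Qed.

Lemma varpiV x : varpi x^-1%g = (varpi x)^-1%g.
Proof. by apply: (mulgI (varpi x)); rewrite -varpiM !mulgV varpi1. Qed.

Lemma normal_A : normal_set A.
Proof.
split; last first.
  by move=> x y; rewrite /kerA /= /conjg !varpiM varpiV => ->; rewrite mul1g mulVg.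
split=> [|x y|x]; rewrite /kerA /= ?varpi1 ?varpiM ?varpiV // => ->.
- by move=> ->; rewrite mulg1.
- by rewrite invg1.
Qed.

Lemma lcs_section_comm n x y : lcs A n x -> lcs A n y -> lcs A n.+1 [~ x, y]%g.
Proof.
move=> Lx Ly; case: n Lx Ly => [|n] Lx Ly.
  by apply: normal_comm_r => //; exact: normal_lcs normal_A 1%N.
by rewrite lcsS; apply: commutator_set_mem => //; exact: lcs_subA normal_A _ _ Ly.
Qed.

Definition lcs_section n := SectionData
  (proj1 (normal_lcs normal_A n)) (proj1 (normal_lcs normal_A n.+1))
  (@lcs_sub _ _ normal_A n) (@lcs_section_comm n).

(* The degree n part Gamma_n A / Gamma_(n+1) A of the graded Lie algebra (it is
   trivial for n = 0), and the class in it of an element of Gamma_n A. *)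
Definition gr n : Type := sec_quot (lcs_section n).
HB.instance Definition _ n := GRing.Zmodule.on (gr n).

Definition cls n (x : pi) : gr n := sec_class (lcs_section n) x.
Definition rep n (a : gr n) : pi := sec_repr a.

Lemma repP n (a : gr n) : lcs A n (rep a).
Proof. exact: sec_reprP. Qed.

Lemma repK n (a : gr n) : cls n (rep a) = a.
Proof. exact: sec_reprK. Qed.

Lemma clsP n x y : lcs A n x -> lcs A n y ->
  cls n x = cls n y <-> lcs A n.+1 (x^-1 * y)%g.
Proof. exact: (@sec_classP _ (lcs_section n)). Qed.

Lemma clsM n x y : lcs A n x -> lcs A n y ->
  cls n (x * y)%g = cls n x + cls n y.
Proof. exact: (@sec_classM _ (lcs_section n)). Qed.

Lemma rep_cls n x : lcs A n x ->
  exists2 k, lcs A n.+1 k & rep (cls n x) = (x * k)%g.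
Proof. exact: (@sec_class_repr _ (lcs_section n)). Qed.

Lemma cls_mod n x k : lcs A n x -> lcs A n.+1 k -> cls n (x * k)%g = cls n x.
Proof. exact: (@sec_class_mod _ (lcs_section n)). Qed.

Lemma cls_eq0 n x : lcs A n.+1 x -> cls n x = 0.
Proof. by move=> Lx; rewrite -[x]mul1g cls_mod //; case: (normal_lcs normal_A n) => [[]]. Qed.

Lemma gr0 (a : gr 0) : a = 0.
Proof. by rewrite -[a]repK; apply: cls_eq0; exact: repP a. Qed.

(* The action of F on gr n is induced by the conjugation x a x^-1 of pi on A. *)
Definition varpi_lift (f : F) : pi := xget 1%g [set x | varpi x = f].

Definition act n (f : F) (a : gr n) : gr n := cls n (rep a ^ (varpi_lift f)^-1)%g.

Lemma varpi_surj f : exists x, varpi x = f.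
Proof.
have [phi [[phiM phi_x] _]] := F_basis H beta.
have [psi [_ psi_uniq]] := F_basis H x_.
have psi_id : psi = idfun by exact: psi_uniq.
have psi_phi : psi = varpi \o phi.
  by apply: psi_uniq; split=> [u v|i] /=; rewrite ?phiM ?varpiM ?phi_x.
by exists (phi f); rewrite -[RHS]/(idfun f) -psi_id psi_phi.
Qed.

Lemma varpi_liftP f : varpi (varpi_lift f) = f.
Proof. by rewrite /varpi_lift; case: xgetP => // nex; case: (varpi_surj f) => x /nex. Qed.

Lemma act_cls n f a x : lcs A n a -> varpi x = f ->
  act f (cls n a) = cls n (a ^ x^-1)%g.
Proof.
have [[L1 LM LV] LJ] := normal_lcs normal_A n.
have [[M1 MM MV] MJ] := normal_lcs normal_A n.+1.
move=> La xf; rewrite /act; have [k Lk ->] := rep_cls La.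
rewrite conjMg cls_mod; [|exact: LJ|exact: MJ].
have -> : ((varpi_lift f)^-1 = x^-1 * (x * (varpi_lift f)^-1))%g by rewrite mulgA mulVg mul1g.
rewrite conjgM; set b := (a ^ x^-1)%g; set u := (x * _)%g.
have Au : A u by rewrite /kerA /= varpiM varpiV xf varpi_liftP mulgV.
have -> : (b ^ u = b * [~ b, u])%g by rewrite commgEl mulgA mulgV mul1g.
apply: cls_mod; first exact: LJ.
have := lcs_comm normal_A (LJ _ x^-1%g La) (Au : lcs A 1 u); by rewrite addn1.
Qed.

Lemma act_action n : linear_action (@act n).
Proof.
have [[L1 LM LV] LJ] := normal_lcs normal_A n.
split=> [a|f h a|f a b].
- by rewrite -[a]repK (act_cls (repP a) varpi1) invg1 conjg1.
- rewrite -[a]repK (act_cls (repP a) (varpi_liftP h)).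
  rewrite (act_cls (LJ _ _ (repP a)) (varpi_liftP f)) -conjgM -invgM.
  by apply: act_cls; [exact: repP|rewrite varpiM !varpi_liftP].
- rewrite -[a]repK -[b]repK -clsM; [|exact: repP..].
  rewrite !(act_cls _ (varpi_liftP f)); [|exact: repP|exact: repP|].
    by rewrite conjMg clsM //; apply: (LJ); exact: repP.
  by apply: (LM); exact: repP.
Qed.

HB.instance Definition _ n := GRing.Zmodule_isLmodule.Build (group_ring F) (gr n)
  (action_scaleA (act_action n)) (action_scale1 (act_action n))
  (action_scaleDr (act_action n)) (action_scaleDl (@act n)).

Lemma cls_conjA n b u : lcs A n b -> A u -> cls n (b ^ u)%g = cls n b.
Proof.
move=> Lb Au; have -> : (b ^ u = b * [~ b, u])%g by rewrite commgEl mulgA mulgV mul1g.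
apply: cls_mod => //.
by have := lcs_comm normal_A Lb (Au : lcs A 1 u); rewrite addn1.
Qed.

(* The Lie bracket is induced by the group commutator. *)
Definition lie i j (a : gr i) (b : gr j) : gr (i + j) :=
  cls (i + j) [~ rep a, rep b]%g.

Lemma lie_cls i j x y : lcs A i x -> lcs A j y ->
  lie (cls i x) (cls j y) = cls (i + j) [~ x, y]%g.
Proof.
move=> Lx Ly; rewrite /lie.
have LJ n a b : lcs A n a -> lcs A n (a ^ b)%g.
  by case: (normal_lcs normal_A n) => _; apply.
have LV n a : lcs A n a -> lcs A n a^-1%g.
  by case: (normal_lcs normal_A n) => [[_ _ h] _]; apply: h.
have subA n a : lcs A n a -> A a by apply: lcs_subA normal_A _ _.
have [k Lk ->] := rep_cls Lx; have [l Ll ->] := rep_cls Ly.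
have Lyl : lcs A j (y * l)%g.
  have [[_ LM _] _] := normal_lcs normal_A j.
  by apply: LM => //; exact: lcs_sub normal_A _ _ Ll.
have -> : ([~ x * k, y * l] = [~ x, y * l] ^ k * [~ k, y * l])%g.
  by rewrite /commg /conjg !gnorm.
have Lc := lcs_comm normal_A Lx Lyl.
rewrite cls_mod; [|exact: LJ|by have := lcs_comm normal_A Lk Lyl; rewrite addSn].
rewrite cls_conjA //; last exact: subA Lk.
have Lxy := lcs_comm normal_A Lx Ly.
have Lxl : lcs A (i + j).+1 [~ x, l]%g.
  by have := lcs_comm normal_A Lx Ll; rewrite addnS.
rewrite commg_mulr clsM; [|exact: lcs_sub normal_A _ _ Lxl|exact: LJ].
by rewrite (cls_eq0 Lxl) add0r cls_conjA //; exact: subA Ll.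
Qed.

Lemma lieDl i j (a a' : gr i) (b : gr j) : lie (a + a') b = lie a b + lie a' b.
Proof.
have [[_ LM _] _] := normal_lcs normal_A i.
have [_ LJ] := normal_lcs normal_A (i + j)%N.
rewrite -[a]repK -[a']repK -[b]repK -clsM; [|exact: repP..].
rewrite !lie_cls; [|try exact: repP..]; last by apply: (LM); exact: repP.
have Lab := lcs_comm normal_A (repP a) (repP b).
have -> (u v w : pi) : ([~ u * v, w] = [~ u, w] ^ v * [~ v, w])%g.
  by rewrite /commg /conjg !gnorm.
rewrite clsM; [|exact: (LJ)|exact: lcs_comm normal_A _ _ _ _ (repP a') (repP b)].
by rewrite cls_conjA //; exact: lcs_subA normal_A _ _ (repP a').
Qed.

Lemma lieDr i j (a : gr i) (b b' : gr j) : lie a (b + b') = lie a b + lie a b'.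
Proof.
have [[_ LM _] _] := normal_lcs normal_A j.
have [_ LJ] := normal_lcs normal_A (i + j)%N.
rewrite -[a]repK -[b]repK -[b']repK -clsM; [|exact: repP..].
rewrite !lie_cls; [|try exact: repP..]; last by apply: (LM); exact: repP.
have Lab := lcs_comm normal_A (repP a) (repP b).
rewrite commg_mulr addrC.
rewrite clsM; [|exact: lcs_comm normal_A _ _ _ _ (repP a) (repP b')|exact: (LJ)].
by rewrite cls_conjA //; exact: lcs_subA normal_A _ _ (repP b').
Qed.

Lemma lie0l i j (b : gr j) : lie (0 : gr i) b = 0.
Proof. by apply: (addrI (lie 0 b)); rewrite -lieDl !addr0. Qed.

Lemma lie0r i j (a : gr i) : lie a (0 : gr j) = 0.
Proof. by apply: (addrI (lie a 0)); rewrite -lieDr !addr0. Qed.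

Lemma lieNl i j (a : gr i) (b : gr j) : lie (- a) b = - lie a b.
Proof. by apply: (addrI (lie a b)); rewrite -lieDl !subrr lie0l. Qed.

Lemma lie_act f i j (a : gr i) (b : gr j) :
  of_group f *: lie a b = lie (of_group f *: a) (of_group f *: b).
Proof.
rewrite -[a]repK -[b]repK lie_cls; [|exact: repP..].
rewrite ![_ *: _]action_scaleU.
have LJ n x y : lcs A n x -> lcs A n (x ^ y)%g.
  by case: (normal_lcs normal_A n) => _; apply.
rewrite !(act_cls _ (varpi_liftP f)); try exact: repP; last first.
  by apply: lcs_comm normal_A _ _ _ _ _ _; exact: repP.
by rewrite conjRg lie_cls //; apply: (LJ); exact: repP.
Qed.

Lemma alphaA i : A (alpha i).
Proof. by have := kerP H; rewrite -/kerA => ->; apply: sub_gen_smallest; exists i. Qed.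

(* A consistency check of the conventions. *)
Lemma cls_zeta :
  cls 1 zeta = \sum_(i < g) (1 - of_group (x_ i)^-1%g) *: cls 1 (alpha i).
Proof.
have [[A1 AM AV] AJ] := normal_A.
have cls1 : cls 1 1%g = 0.
  by have [[L1 _ _] _] := normal_lcs normal_A 2; exact: cls_eq0.
have clsV x : A x -> cls 1 x^-1%g = - cls 1 x.
  move=> Ax; apply: (addrI (cls 1 x)); rewrite -clsM ?subrr ?mulgV //.
  exact: AV.
have Ac i : A [~ beta i, (alpha i)^-1]%g.
  by apply: normal_comm_l; [exact: normal_A|apply: AV; exact: alphaA].
rewrite /zeta; set P := (\prod_(i < g) _)%g.
have [AP clsP] : A P /\ cls 1 P = \sum_(i < g) cls 1 [~ beta i, (alpha i)^-1]%g.
  apply: (big_rec2 (fun x a => A x /\ cls 1 x = a)) => [|i x a _ [Ax <-]] //.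
  by split; [exact: AM (Ac i) Ax|exact: (@clsM 1 _ _ (Ac i) Ax)].
rewrite clsV // clsP -sumrN; apply: eq_bigr => i _.
have -> : ([~ beta i, (alpha i)^-1] = alpha i ^ beta i * (alpha i)^-1)%g.
  by rewrite /commg /conjg !gnorm.
have Aa := alphaA i.
rewrite clsM; [|exact: AJ|exact: AV].
rewrite clsV // opprB scalerBl scale1r; congr (_ - _).
have xV : varpi (beta i)^-1%g = (x_ i)^-1%g by exact: varpiV.
by rewrite [RHS]action_scaleU (act_cls (Aa : lcs A 1 _) xV) invgK.
Qed.

Definition gr_cast m n (e : m = n) (a : gr m) : gr n := ecast k (gr k) e a.

Lemma gr_castD m n (e : m = n) a b : gr_cast e (a + b) = gr_cast e a + gr_cast e b.
Proof. by case: _ / e. Qed.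

Lemma gr_cast0 m n (e : m = n) : gr_cast e 0 = 0.
Proof. by case: _ / e. Qed.

Definition Abar : Type := direct_sum gr.
HB.instance Definition _ := GRing.Zmodule.on Abar.

Lemma Abar_actP f (a : Abar) : finitely_supported (fun n => act f (a n)).
Proof.
by have [N aN] := componentP a; exists N => n /aN ->; rewrite (linear_action0 (act_action n)).
Qed.

Definition Abar_act f (a : Abar) : Abar := DirectSum (Abar_actP f a).

Lemma Abar_act_action : linear_action Abar_act.
Proof.
split=> [a|f h a|f a b]; apply: direct_sum_ext => n /=;
  have [a1 aM aD] := act_action n.
- exact: a1.
- exact: aM.
- exact: aD.
Qed.

HB.instance Definition _ := GRing.Zmodule_isLmodule.Build (group_ring F) Abar
  (action_scaleA Abar_act_action) (action_scale1 Abar_act_action)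
  (action_scaleDr Abar_act_action) (action_scaleDl Abar_act).

Lemma Abar_lieP (a b : Abar) : finitely_supported (fun n =>
  \sum_(i < n.+1) gr_cast (subnKC (leq_ord i)) (lie (a i) (b (n - i)%N))).
Proof.
have [M aM] := componentP a; have [N bN] := componentP b.
exists (M + N)%N => n leMNn; apply: big1 => i _.
have [leMi|ltiM] := leqP M i; first by rewrite aM // lie0l gr_cast0.
rewrite bN ?lie0r ?gr_cast0 // leq_subRL ?leq_ord //.
by apply: leq_trans leMNn; rewrite leq_add2r ltnW.
Qed.

Definition Abar_lie (a b : Abar) : Abar := DirectSum (Abar_lieP a b).

Lemma Abar1P (a : gr 1) : finitely_supported
  (fun n => if n is 1 return gr n then a else 0).
Proof. by exists 2 => -[|[|n]]. Qed.

(* The abelianization of A is the degree 1 part of Abar_+. *)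
Definition Abar1 (a : gr 1) : Abar := DirectSum (Abar1P a).

Section Derivations.
Variable m : nat.

(* The condition on dp 0 : gr 0 -> gr (m + 0) is void since gr 0 = 0. *)
Definition derivation (d0 : F -> gr m) (dp : forall i, gr i -> gr (m + i)) :=
  [/\ forall f h, d0 (f * h)%g = d0 f + of_group f *: d0 h,
      forall i (a b : gr i), dp i (a + b) = dp i a + dp i b,
      forall i j (a : gr i) (b : gr j),
        dp (i + j)%N (lie a b)
        = gr_cast (esym (addnA m i j)) (lie (dp i a) b)
          + gr_cast (addnCA i m j) (lie a (dp j b))
    & forall i f (b : gr i),
        dp i (of_group f *: b)
        = of_group f *: dp i b + lie (d0 f) (of_group f *: b)].

(* The derivations of degree m that vanish on the class of zeta. *)
Record der_zeta := DerZeta {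
  der0 : F -> gr m;
  derp : forall i, gr i -> gr (m + i);
  der_zetaP : derivation der0 derp;
  der_zeta0 : derp (cls 1 zeta) = 0
}.

HB.instance Definition _ := gen_eqMixin der_zeta.
HB.instance Definition _ := gen_choiceMixin der_zeta.

Lemma der_zeta_ext (d e : der_zeta) : der0 d =1 der0 e ->
  (forall i, @derp d i =1 @derp e i) -> d = e.
Proof.
case: d e => [d0 dp dP dz] [e0 ep eP ez] /= /funext de0 dep.
have {}dep : dp = ep.
  by apply: functional_extensionality_dep => i; exact/funext/dep.
by subst e0 ep; congr DerZeta; exact: Prop_irrelevance.
Qed.

Lemma gr_castN p q (e : p = q) a : gr_cast e (- a) = - gr_cast e a.
Proof. by case: _ / e. Qed.

Lemma lieNr i j (a : gr i) (b : gr j) : lie a (- b) = - lie a b.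
Proof. by apply: (addrI (lie a b)); rewrite -lieDr !subrr lie0r. Qed.

Lemma derivation0 : derivation (fun=> 0) (fun i _ => 0).
Proof.
split=> [f h|i a b|i j a b|i f b].
- by rewrite scaler0 addr0.
- by rewrite addr0.
- by rewrite lie0l lie0r !gr_cast0 addr0.
- by rewrite scaler0 lie0l addr0.
Qed.

Lemma derivationD d0 dp e0 ep : derivation d0 dp -> derivation e0 ep ->
  derivation (fun f => d0 f + e0 f) (fun i a => dp i a + ep i a).
Proof.
move=> [d1 d2 d3 d4] [e1 e2 e3 e4]; split=> [f h|i a b|i j a b|i f b].
- by rewrite d1 e1 scalerDr addrACA.
- by rewrite d2 e2 addrACA.
- by rewrite d3 e3 lieDl lieDr !gr_castD addrACA.
- by rewrite d4 e4 scalerDr lieDl addrACA.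
Qed.

Lemma derivationN d0 dp : derivation d0 dp ->
  derivation (fun f => - d0 f) (fun i a => - dp i a).
Proof.
move=> [d1 d2 d3 d4]; split=> [f h|i a b|i j a b|i f b].
- by rewrite d1 scalerN opprD.
- by rewrite d2 opprD.
- by rewrite d3 lieNl lieNr !gr_castN opprD.
- by rewrite d4 scalerN lieNl opprD.
Qed.

Definition der_zeta_zero : der_zeta :=
  @DerZeta (fun=> 0) (fun i _ => 0) derivation0 erefl.

Lemma der_zeta_addP (d e : der_zeta) : derp d (cls 1 zeta) + derp e (cls 1 zeta) = 0.
Proof. by rewrite !der_zeta0 addr0. Qed.

Definition der_zeta_add (d e : der_zeta) : der_zeta :=
  DerZeta (derivationD (der_zetaP d) (der_zetaP e)) (der_zeta_addP d e).

Lemma der_zeta_oppP (d : der_zeta) : - derp d (cls 1 zeta) = 0.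
Proof. by rewrite der_zeta0 oppr0. Qed.

Definition der_zeta_opp (d : der_zeta) : der_zeta :=
  DerZeta (derivationN (der_zetaP d)) (der_zeta_oppP d).

Lemma der_zeta_addA : associative der_zeta_add.
Proof. by move=> a b c; apply: der_zeta_ext => [f|i x]; exact: addrA. Qed.
Lemma der_zeta_addC : commutative der_zeta_add.
Proof. by move=> a b; apply: der_zeta_ext => [f|i x]; exact: addrC. Qed.
Lemma der_zeta_add0 : left_id der_zeta_zero der_zeta_add.
Proof. by move=> a; apply: der_zeta_ext => [f|i x]; exact: add0r. Qed.
Lemma der_zeta_addN : left_inverse der_zeta_zero der_zeta_opp der_zeta_add.
Proof. by move=> a; apply: der_zeta_ext => [f|i x]; exact: addNr. Qed.

HB.instance Definition _ := GRing.isZmodule.Build der_zeta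
  der_zeta_addA der_zeta_addC der_zeta_add0 der_zeta_addN.

End Derivations.

(* The direct sum over m >= 1 of the groups der_zeta m. *)
Definition Der_plus_zeta : Type := direct_sum (fun k => der_zeta k.+1).
HB.instance Definition _ := GRing.Zmodule.on Der_plus_zeta.

Lemma der_restrP (d : Der_plus_zeta) f : finitely_supported
  (fun n => if n is k.+1 return gr n then der0 (d k) f else 0).
Proof.
by have [N dN] := componentP d; exists N.+1 => -[|k] //; rewrite ltnS => /dN ->.
Qed.

(* The map (d_i)_i |-> d_0. *)
Definition der_restr (d : Der_plus_zeta) (f : F) : Abar := DirectSum (der_restrP d f).

(* The right Z[F]-module structure on gr 1 with a . f = f^-1 a. *)
Definition ract (a : gr 1) (s : group_ring F) : gr 1 := antipode s *: a.

Definition cocycle (M : lmodType (group_ring F)) (c : F -> M) :=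
  forall f h, c (f * h)%g = c f + of_group f *: c h.

(* The inverse of the map sending u (x) m to the cocycle f |-> <f, u> m, where
   <-,-> is the pairing of Z[F] with gr 1 induced by the homotopy intersection
   form, for which <x_i, a_j> = - delta_ij. *)
Definition theta (M : lmodType (group_ring F)) (c : F -> M) : tensor ract M :=
  - \sum_(i < g) tens ract (cls 1 (alpha i)) (c (x_ i)).

(* Abar_+ / I_F Abar_+, with I_F the augmentation ideal of Z[F]. *)
Definition Abar_coinv : Type := {ideal_quot zspan
  [set s *: a | s in @augmentation_ideal F & a in @setT Abar]}.
HB.instance Definition _ := GRing.Zmodule.on Abar_coinv.

Definition coinv_class (a : Abar) : Abar_coinv := \pi_Abar_coinv%qT a.

Definition bracket_pair (p : gr 1 * Abar) : Abar_coinv :=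
  coinv_class (Abar_lie (Abar1 p.1) p.2).

(* The map induced by the Lie bracket; see bracket_map_tens. *)
Definition bracket_map (t : tensor ract Abar) : Abar_coinv :=
  zlift bracket_pair (repr t).

Lemma coinv_classB a b : coinv_class (a - b) = coinv_class a - coinv_class b.
Proof. by rewrite /coinv_class !piE. Qed.

Lemma coinv_classD a b : coinv_class (a + b) = coinv_class a + coinv_class b.
Proof. by rewrite /coinv_class !piE. Qed.

Lemma coinv_class_eq s a : augmentation s = 0 -> coinv_class (s *: a) = 0.
Proof.
move=> s0; rewrite -[RHS](subrr (coinv_class 0)) -coinv_classB subr0.
apply/eqP; rewrite -Quotient.idealrBE subr0; apply/asboolP.
by apply: sub_gen_smallest; exists s => //; exists a.
Qed.

Lemma Abar_scaleE f (a : Abar) n : (of_group f *: a) n = of_group f *: a n.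
Proof. by rewrite ![_ *: _]action_scaleU. Qed.

Lemma Abar1D a b : Abar1 (a + b) = Abar1 a + Abar1 b.
Proof. by apply: direct_sum_ext => -[|[|n]] //=; rewrite addr0. Qed.

Lemma Abar1_act f a : Abar1 (of_group f *: a) = of_group f *: Abar1 a.
Proof.
by apply: direct_sum_ext => -[|[|n]]; rewrite Abar_scaleE //= scaler0.
Qed.

Lemma Abar_lieDl a a' b : Abar_lie (a + a') b = Abar_lie a b + Abar_lie a' b.
Proof.
apply: direct_sum_ext => n /=; rewrite -big_split; apply: eq_bigr => i _ /=.
by rewrite lieDl gr_castD.
Qed.

Lemma Abar_lieDr a b b' : Abar_lie a (b + b') = Abar_lie a b + Abar_lie a b'.
Proof.
apply: direct_sum_ext => n /=; rewrite -big_split; apply: eq_bigr => i _ /=.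
by rewrite lieDr gr_castD.
Qed.

Lemma gr_castZ p q (e : p = q) s a : gr_cast e (s *: a) = s *: gr_cast e a.
Proof. by case: _ / e. Qed.

Lemma Abar_lie_act f a b :
  of_group f *: Abar_lie a b = Abar_lie (of_group f *: a) (of_group f *: b).
Proof.
apply: direct_sum_ext => n; rewrite Abar_scaleE /= scaler_sumr.
by apply: eq_bigr => i _; rewrite !Abar_scaleE -lie_act gr_castZ.
Qed.

Lemma bracket_pairDl u u' m :
  bracket_pair (u + u', m) = bracket_pair (u, m) + bracket_pair (u', m).
Proof. by rewrite /bracket_pair /= Abar1D Abar_lieDl coinv_classD. Qed.

Lemma bracket_pairDr u m m' :
  bracket_pair (u, m + m') = bracket_pair (u, m) + bracket_pair (u, m').
Proof. by rewrite /bracket_pair /= Abar_lieDr coinv_classD. Qed.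

Lemma bracket_pair0l m : bracket_pair (0, m) = 0.
Proof. by apply: (addrI (bracket_pair (0, m))); rewrite -bracket_pairDl !addr0. Qed.

Lemma bracket_pair0r u : bracket_pair (u, 0) = 0.
Proof. by apply: (addrI (bracket_pair (u, 0))); rewrite -bracket_pairDr !addr0. Qed.

Lemma bracket_pairNl u m : bracket_pair (- u, m) = - bracket_pair (u, m).
Proof.
by apply: (addrI (bracket_pair (u, m))); rewrite -bracket_pairDl !subrr bracket_pair0l.
Qed.

Lemma bracket_pairNr u m : bracket_pair (u, - m) = - bracket_pair (u, m).
Proof.
by apply: (addrI (bracket_pair (u, m))); rewrite -bracket_pairDr !subrr bracket_pair0r.
Qed.

Lemma bracket_pair_ract u s m :
  bracket_pair (ract u s, m) = bracket_pair (u, s *: m).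
Proof.
rewrite /ract; elim/malg_ind: s => [|f|s t IHs IHt].
- by rewrite [antipode 0]raddf0 !scale0r bracket_pair0l bracket_pair0r.
- rewrite [antipode _]zliftU /bracket_pair /= Abar1_act.
  set w := Abar_lie (Abar1 u) (of_group f *: m).
  have -> : Abar_lie (of_group f^-1%g *: Abar1 u) m = of_group f^-1%g *: w.
    by rewrite Abar_lie_act scalerA [_ * _]of_group_mul mulVg scale1r.
  apply/eqP; rewrite -subr_eq0 -coinv_classB -{2}[w]scale1r -scalerBl.
  apply/eqP/coinv_class_eq.
  by rewrite [augmentation _]raddfB /= !zliftU subrr.
- rewrite [antipode _]raddfB !scalerBl bracket_pairDl bracket_pairNl.
  by rewrite bracket_pairDr bracket_pairNr IHs IHt.
Qed.

Lemma zlift_bracket_pair x :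
  x \in zspan (tensor_relations ract (M := Abar)) -> zlift bracket_pair x = 0.
Proof.
move=> /asboolP Sx; apply: (Sx [set y | zlift bracket_pair y = 0]).
split=> [|y [[|]|]] /=.
- by split=> [|y z y0 z0] /=; [exact: raddf0|rewrite raddfB /= y0 z0 subrr].
- move=> [u [u' [m ->]]]; rewrite [LHS]zlift_sub3 bracket_pairDl.
  by rewrite -addrA -opprD subrr.
- move=> [u [m [m' ->]]]; rewrite [LHS]zlift_sub3 bracket_pairDr.
  by rewrite -addrA -opprD subrr.
- by move=> [u [s [m ->]]]; rewrite [LHS]zlift_sub2 bracket_pair_ract subrr.
Qed.

Lemma bracket_map_pi x :
  bracket_map (\pi_(tensor ract Abar)%qT x) = zlift bracket_pair x.
Proof.
apply/eqP; rewrite /bracket_map -subr_eq0 -raddfB; apply/eqP/zlift_bracket_pair.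
by rewrite Quotient.idealrBE reprK.
Qed.

Lemma bracket_map_tens u m :
  bracket_map (tens ract u m) = coinv_class (Abar_lie (Abar1 u) m).
Proof. by rewrite bracket_map_pi zliftU. Qed.

Lemma bracket_map_is_additive : zmod_morphism bracket_map.
Proof.
move=> t u; rewrite -[t]reprK -[u]reprK.
have -> : \pi_(tensor ract Abar)%qT (repr t) - \pi_(tensor ract Abar)%qT (repr u)
          = \pi_(tensor ract Abar)%qT (repr t - repr u) by rewrite !piE.
by rewrite !bracket_map_pi raddfB.
Qed.

Definition D_plus0 : set (F -> Abar) :=
  [set c | cocycle c /\ bracket_map (theta c) = 0].

End Handlebody.

(* Main.v *)
Require Import Defs.
From HB Require Import structures.
From mathcomp Require Import all_boot all_order all_algebra.
From mathcomp Require Import finmap.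
From mathcomp Require Import boolp classical_sets functions.
From mathcomp Require Import fsbigop.
From mathcomp.multinomials Require Import monalg.

(** A derivation [d] of positive degree that kills the class of [zeta] satisfies
    [0 = sum_i (1 - x_i^-1) d(a_i) + sum_i x_i^-1 [d_0(x_i), a_i]]
    ([derivation_zeta]), because [[zeta] = sum_i (1 - x_i^-1) a_i]. As the
    elements [1 - x_i^-1] generate the augmentation ideal as a right ideal, this
    says that the cocycle [d_0] satisfies the equation that defines [D_+^0]
    ([bracket_theta0P]), and that the values [d(a_i)] are solutions of a linear
    equation whose right-hand side depends on [d_0] only. The theorem follows
    from two facts: these solutions are unique, and every solution comes from a
    derivation. Both are obtained from the freeness of [pi] and [F] alone,
    without a description of the free Lie algebra.

    Uniqueness ([gr_indep]) is the vanishing of the first homology group of [F]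
    with coefficients in the degree [n] part of the graded Lie algebra. The
    group [A] is free on the letters [f alpha_j f^-1], with [f] in [F]
    ([letter_free], [letter_ext]), so a letter can be killed by an endomorphism
    of [A]. For a fixed [j], the difference [r] between the identity and the
    endomorphism that kills [alpha_j] sends a class [m] to a function
    [h |-> r(h^-1 m)] on [F]. It has finite support because a word involves
    finitely many letters; and these functions for all [j] determine [m],
    because a class fixed by killing any one letter is fixed by killing all the
    letters of a word that represents it, hence is zero. The map to finitely
    supported functions is equivariant, and for such functions the statement is
    the independence of the [1 - x_i^-1] ([free_basis_indep]): the Cayley graph
    of [F] is a tree, so every function on its edges is the coboundary of a
    function on its vertices, against which one can sum.

    Existence ([der_zeta_exists]): given the cocycle [c] and the values [y_i],
    let [phi] be the endomorphism of [pi] with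
    [phi(alpha_i) = y_i alpha_i] and [phi(beta_i) = c(x_i) beta_i], for
    representatives of the classes [y_i] and [c(x_i)] in the lower central
    series of [A]. The map [x |-> phi(x) x^-1] raises the lower central degree
    by [m], and commutator identities show that the map it induces on the
    graded quotients is the wanted derivation ([endo_derP]). *)

Set Implicit Arguments.
Unset Strict Implicit.
Unset Printing Implicit Defensive.

Import GRing.Theory.

Local Open Scope classical_set_scope.

(** * Free bases: generation, and functions on the Cayley graph *)

Lemma morph_group1 (G K : groupType) (phi : G -> K) :
  {morph phi : x y / (x * y)%g} -> phi 1%g = 1%g.
Proof. by move=> phiM; apply: (mulgI (phi 1%g)); rewrite -phiM !mulg1. Qed.

Lemma morph_groupV (G K : groupType) (phi : G -> K) :
  {morph phi : x y / (x * y)%g} -> {morph phi : x / x^-1%g}.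
Proof.
by move=> phiM x; apply: (mulgI (phi x)); rewrite -phiM !mulgV (morph_group1 phiM).
Qed.

Section Generation.
Local Open Scope group_scope.
Variables (G : groupType) (P : set G) (sP : subgroup_set P).

Definition subgroup_pred : {pred G} := [pred x | `[< P x >]].

Lemma subgroup_pred_closed : group_closed subgroup_pred.
Proof.
have [P1 PM PV] := sP; split; first exact/asboolP.
by move=> x y /asboolP Px /asboolP Py; apply/asboolP; apply/PM/PV.
Qed.

Record subgroup_type := SubgroupType {
  subgroup_val :> G;
  subgroup_valP : subgroup_val \in subgroup_pred
}.

HB.instance Definition _ := [isSub of subgroup_type for subgroup_val].
HB.instance Definition _ := [Choice of subgroup_type by <:].
HB.instance Definition _ :=
  SubChoice_isSubGroup.Build G subgroup_pred subgroup_type subgroup_pred_closed.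

(** The universal property gives a retraction of [G] onto the subgroup [P] that
    fixes the basis; by its uniqueness part this retraction is the identity. *)
Lemma free_basis_ind (I : Type) (e : I -> G) : free_basis e ->
  (forall i, P (e i)) -> forall x, P x.
Proof.
move=> fe Pe x.
have Pe' i : e i \in subgroup_pred by exact/asboolP.
have [phi [[phiM phi_e] _]] := fe subgroup_type (fun i => SubgroupType (Pe' i)).
have [psi [_ psi_uniq]] := fe G e.
have psi_id : psi = idfun by exact: psi_uniq.
have psi_phi : psi = fun x => subgroup_val (phi x).
  apply: psi_uniq; split=> [u v|i]; last by rewrite phi_e.
  by rewrite phiM.
have -> : x = phi x by rewrite -[LHS]/(idfun x) -psi_id psi_phi.
exact/asboolP/subgroup_valP.
Qed.

End Generation.

Section Wreath.
Local Open Scope group_scope.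
Variables (K F : groupType).

(** The semidirect product of the functions [F -> K] with [F], which acts on
    them by right translation of the argument. Both the tree property of free
    groups and the freeness of the kernel of [varpi] come from homomorphisms to
    such a group: their first components are cocycles with coinduced
    coefficients. *)
Definition wreath : Type := ((F -> K) * F)%type.
HB.instance Definition _ := gen_eqMixin wreath.
HB.instance Definition _ := gen_choiceMixin wreath.

Definition wreath_mul (u v : wreath) : wreath :=
  (fun h => u.1 h * v.1 (h * u.2), u.2 * v.2).
Definition wreath_one : wreath := (fun=> 1, 1).
Definition wreath_inv (u : wreath) : wreath :=
  (fun h => (u.1 (h * u.2^-1))^-1, u.2^-1).

Lemma wreath_mulA : associative wreath_mul.
Proof.
by move=> u v w; congr (_, _); rewrite /= ?mulgA //; apply/funext => h; rewrite !mulgA.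
Qed.

Lemma wreath_mul1 : left_id wreath_one wreath_mul.
Proof.
move=> [u f]; rewrite /wreath_mul /= mul1g; congr (_, _).
by apply/funext => h; rewrite mul1g mulg1.
Qed.

Lemma wreath_mulr1 : right_id wreath_one wreath_mul.
Proof.
move=> [u f]; rewrite /wreath_mul /= mulg1; congr (_, _).
by apply/funext => h; rewrite mulg1.
Qed.

Lemma wreath_mulV : left_inverse wreath_one wreath_inv wreath_mul.
Proof.
move=> [u f]; rewrite /wreath_mul /= mulVg; congr (_, _).
by apply/funext => h; rewrite mulVg.
Qed.

Lemma wreath_mulrV : right_inverse wreath_one wreath_inv wreath_mul.
Proof.
move=> [u f]; rewrite /wreath_mul /= mulgV; congr (_, _).
by apply/funext => h; rewrite mulgK mulgV.
Qed.

HB.instance Definition _ := isGroup.Build wreath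
  wreath_mulA wreath_mul1 wreath_mulr1 wreath_mulV wreath_mulrV.

Lemma wreathM (u v : wreath) : u * v = (fun h => u.1 h * v.1 (h * u.2), u.2 * v.2).
Proof. by []. Qed.

End Wreath.

(** Homomorphisms of groups to [V] need its addition as a group law. *)
Definition additive_group (V : zmodType) : Type := V.
HB.instance Definition _ (V : zmodType) := Choice.on (additive_group V).
HB.instance Definition _ (V : zmodType) := isGroup.Build (additive_group V)
  (@addrA V) (@add0r V) (@addr0 V) (@addNr V) (@addrN V).

Section Potential.
Variables (F : groupType) (I : Type) (x : I -> F) (V : zmodType).

(** The Cayley graph of a free group is a tree, so a function on its edges is
    the coboundary of a function on its vertices. Algebraically, [psi] is the
    value at [1] of the cocycle that sends [x i] to [s i]. *)
Lemma free_basis_potential (s : I -> F -> V) : free_basis x ->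
  exists psi : F -> V, forall h i, psi (h * x i)%g = (psi h + s i h)%R.
Proof.
move=> fx.
have [phi [[phiM phi_x] _]] := fx (wreath (additive_group V) F) (fun i => (s i, x i)).
have [rho [_ rho_uniq]] := fx F x.
have rho_id : rho = idfun by exact: rho_uniq.
have rho_phi : rho = fun h => (phi h).2.
  by apply: rho_uniq; split=> [u v|i]; rewrite ?phi_x // phiM.
have phi2 h : (phi h).2 = h by rewrite -[RHS]/(idfun h) -rho_id rho_phi.
exists (fun h => (phi h).1 1%g) => h i.
by rewrite phiM phi_x /= phi2 mul1g.
Qed.

End Potential.

Section FreeGroupIndependence.
Variables (F : groupType) (g : nat) (x : 'I_g -> F) (V : zmodType).

(** In terms of the element [sum_h u_j(h) h] of [V] tensored with [Z[F]], this is
    the independence of the [1 - x_j^-1]: each side is paired with a function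
    [psi] whose coboundary is the indicator of one edge, chosen so that only
    [u_k(h0)] survives. *)
Lemma free_basis_indep (u : 'I_g -> F -> V) : free_basis x ->
  (exists S : seq F, forall j h, h \notin S -> u j h = 0%R) ->
  (forall h, (\sum_j (u j h - u j (x j * h)%g) = 0)%R) ->
  forall j h, u j h = 0%R.
Proof.
move=> fx [S uS] sum_u k h0.
pose s j h : int := ((j == k) && (h == h0^-1)%g)%:R%R.
have [psi psiP] := free_basis_potential s fx.
(* D contains the supports of both families of terms, so that finite sums over
   D equal sums over F, where translations are allowed. *)
pose D : {fset F} := [fset h | h in S ++ [seq (x j)^-1 * h | j <- enum 'I_g, h <- S]]%g%fset.
have uD j h : h \notin D -> u j h = 0%R.
  by move=> hD; apply: uS; apply: contra hD => hS; rewrite !inE; apply/orP; left.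
have uxD j h : h \notin D -> u j (x j * h)%g = 0%R.
  move=> hD; apply: uS; apply: contra hD => hS; rewrite !inE; apply/orP; right.
  by apply/allpairsP; exists (j, (x j * h)%g); rewrite mem_enum mulKg.
have shift j : (\sum_(h <- D) u j (x j * h)%g *~ psi h^-1%g
    = \sum_(h <- D) u j h *~ (psi h^-1%g + s j h^-1%g))%R.
  rewrite -[LHS]fsbigTE; last by move=> h hD; rewrite uxD // mul0rz.
  rewrite -[RHS]fsbigTE; last by move=> h hD; rewrite uD // mul0rz.
  rewrite [RHS](reindex_fsbigT (fun h => x j * h)%g); last first.
    by exists (fun h => (x j)^-1 * h)%g => h; rewrite ?mulKg ?mulVKg.
  apply: eq_fsbigr => h _; congr (_ *~ _)%R.
  by rewrite -psiP invgM mulgVK.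
have : (\sum_j \sum_(h <- D) u j h *~ s j h^-1%g = 0)%R.
  transitivity (- \sum_(h <- D) (\sum_j (u j h - u j (x j * h)%g)) *~ psi h^-1%g)%R; last first.
    by rewrite big1 ?oppr0 // => h _; rewrite sum_u mul0rz.
  under [in RHS]eq_bigr do rewrite mulrz_suml.
  rewrite [in RHS]exchange_big -sumrN; apply: eq_bigr => j _ /=.
  under [in RHS]eq_bigr do rewrite mulrzBl.
  rewrite sumrB shift -sumrB -sumrN; apply: eq_bigr => h _.
  by rewrite mulrzDr opprB addrC addKr.
rewrite (bigD1 k) //= [X in (_ + X)%R]big1 ?addr0; last first.
  by move=> j /negPf jk; apply: big1 => h _; rewrite /s jk mulr0z.
have [h0D|/uD //] := boolP (h0 \in D).
rewrite (big_fsetD1 h0) //= big_seq big1 ?addr0; last first.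
  move=> h; rewrite !inE => /andP[/negPf hh0 _].
  by rewrite /s eqxx (inj_eq invg_inj) hh0 mulr0z.
by rewrite /s !eqxx mulr1z.
Qed.

End FreeGroupIndependence.

(** * The kernel of varpi is free on the conjugates of the meridians *)

Section Letters.
Variables (g : nat) (H : handlebody g).
Local Notation pi := (pi_ H).
Local Notation F := (F_ H).
Local Notation alpha := (@alpha g H).
Local Notation beta := (@beta g H).
Local Notation varpi := (@varpi g H).
Local Notation A := (@kerA g H).
Local Notation x_ := (@x_ g H).
Local Open Scope group_scope.

Lemma varpi_split : exists sigma : F -> pi,
  [/\ {morph sigma : f h / f * h}, forall i, sigma (x_ i) = beta i
    & cancel sigma varpi].
Proof.
have [sigma [[sM sx] _]] := F_basis H beta.
have [rho [_ rho_uniq]] := F_basis H x_.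
have rho_id : rho = idfun by exact: rho_uniq.
have rho_s : rho = varpi \o sigma.
  by apply: rho_uniq; split=> [u v|i] /=; rewrite ?sM ?varpiM ?sx.
by exists sigma; split=> // f; rewrite -[RHS]/(idfun f) -rho_id rho_s.
Qed.

Definition sigma : F -> pi := sval (cid varpi_split).

Lemma sigmaM : {morph sigma : f h / f * h}.
Proof. by rewrite /sigma; case: cid => s []. Qed.

Lemma sigma_x i : sigma (x_ i) = beta i.
Proof. by rewrite /sigma; case: cid => s []. Qed.

Lemma sigmaK : cancel sigma varpi.
Proof. by rewrite /sigma; case: cid => s []. Qed.

Lemma sigma1 : sigma 1 = 1.
Proof. exact: morph_group1 sigmaM. Qed.

Lemma sigmaV f : sigma f^-1 = (sigma f)^-1.
Proof. exact: morph_groupV sigmaM _. Qed.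

Definition letter f j : pi := alpha j ^ (sigma f)^-1.

Lemma letter1 j : letter 1 j = alpha j.
Proof. by rewrite /letter sigma1 invg1 conjg1. Qed.

Lemma letter_conj f h j : letter f j ^ (sigma h)^-1 = letter (h * f) j.
Proof. by rewrite /letter -conjgM -invgM -sigmaM. Qed.

Lemma letterA f j : A (letter f j).
Proof. by case: (normal_A H) => _; apply; exact: alphaA. Qed.

(** The subgroup generated by the letters is normal, since conjugation by
    [beta_i] permutes the letters while each [alpha_i] is a letter; so it
    contains the normal closure of the meridians. *)
Lemma letter_ind (P : set pi) : subgroup_set P ->
  (forall f j, P (letter f j)) -> A `<=` P.
Proof.
move=> sP Pl; pose L := range (fun t : F * 'I_g => letter t.1 t.2).
pose B := smallest (@subgroup_set pi) L.
have sB : subgroup_set B := subgroup_set_smallest L.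
have [B1 BM BV] := sB.
have Bl f j : B (letter f j) by apply: sub_gen_smallest; exists (f, j).
have BP : B `<=` P by apply: smallest_sub => // _ [[f j] _ <-].
pose N : set pi := [set u | forall b, B b -> B (b ^ u) /\ B (b ^ u^-1)].
have Bconj u : (forall f j, B (letter f j ^ u)) -> forall b, B b -> B (b ^ u).
  move=> Bu b; move: b; apply: smallest_sub => [|_ [[f j] _ <-]] //=.
  split=> /= [|a b|a]; rewrite ?conj1g ?conjMg ?conjVg //; [exact: BM|exact: BV].
have NT u : N u.
  apply: (free_basis_ind (P := N) _ (pi_basis H)) => [|[i|i] b Bb].
  - split=> [b|v w Nv Nw b Bb|v Nv b Bb]; rewrite ?invg1 ?conjg1 ?invgK //.
      rewrite invgM !conjgM; split; first by apply: (Nw _ _).1; apply: (Nv _ _).1.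
      by apply: (Nv _ _).2; apply: (Nw _ _).2.
    by split; [apply: (Nv _ _).2|apply: (Nv _ _).1].
  - have Ba : B (alpha i) by rewrite -letter1.
    split; rewrite /conjg ?invgK; first exact: BM (BV _ Ba) (BM _ _ Bb Ba).
    exact: BM Ba (BM _ _ Bb (BV _ Ba)).
  - rewrite -sigma_x; split; last by apply: Bconj => // f j; rewrite letter_conj.
    by apply: Bconj => // f j; rewrite -[sigma _]invgK -sigmaV letter_conj.
have nB : normal_set B by split=> // a u /(NT u)[].
apply: subset_trans BP; rewrite /kerA kerP; apply: smallest_sub => // _ [j _ <-].
by rewrite -letter1.
Qed.

(** Homomorphisms on [A] are represented by functions on the whole of [pi], so
    that [A] need not be made into a type. *)
Definition mult_on_A (K : groupType) (kappa : pi -> K) :=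
  forall a b, A a -> A b -> kappa (a * b) = kappa a * kappa b.

Lemma mult_on_A1 (K : groupType) (kappa : pi -> K) : mult_on_A kappa -> kappa 1 = 1.
Proof.
have A1 : A 1 by case: (normal_A H) => [[]].
by move=> kM; apply: (mulgI (kappa 1)); rewrite -kM // !mulg1.
Qed.

Lemma mult_on_AV (K : groupType) (kappa : pi -> K) a : mult_on_A kappa -> A a ->
  kappa a^-1 = (kappa a)^-1.
Proof.
move=> kM Aa; have AV : A a^-1 by case: (normal_A H) => [[_ _ h] _]; apply: h.
by apply: (mulgI (kappa a)); rewrite -kM // !mulgV mult_on_A1.
Qed.

Lemma letter_ext (K : groupType) (kappa lambda : pi -> K) :
  mult_on_A kappa -> mult_on_A lambda ->
  (forall f j, kappa (letter f j) = lambda (letter f j)) ->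
  forall a, A a -> kappa a = lambda a.
Proof.
move=> kM lM kl a Aa; have [[A1 AM AV] _] := normal_A H.
suff [] : [set b | A b /\ kappa b = lambda b] a by [].
apply: letter_ind Aa => [|f j] /=; last by split; [exact: letterA|].
split=> /= [|b c [Ab kb] [Ac kc]|b [Ab kb]]; first by rewrite !mult_on_A1.
  by rewrite kM // lM // kb kc; split=> //; exact: AM.
by rewrite !mult_on_AV // kb; split=> //; exact: AV.
Qed.

(** Freeness of [A] on the letters. The homomorphism to the wreath product that
    sends [alpha_j] to [v _ j] and [beta_j] to [x_j] maps [A] to the functions
    [F -> K], on which evaluation at [1] is a homomorphism. *)
Lemma letter_free (K : groupType) (v : F -> 'I_g -> K) :
  exists kappa : pi -> K, mult_on_A kappa /\ forall f j, kappa (letter f j) = v f j.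
Proof.
have [phi [[phiM phi_e] _]] := pi_basis H (fun s : 'I_g + 'I_g =>
  match s with inl j => (fun h => v h j, 1) | inr j => (fun=> 1, x_ j) end : wreath K F).
have phi2 u : (phi u).2 = varpi u.
  have [rho [_ rho_uniq]] := pi_basis H (fun s : 'I_g + 'I_g =>
    match s with inl j => 1 | inr j => x_ j end).
  transitivity (rho u); last first.
    congr (_ u); apply: rho_uniq; split=> [a b|[j|j]] //; first exact: varpiM.
    exact: alphaA.
  have -> // : rho = fun u => (phi u).2.
  by apply: rho_uniq; split=> [a b|[j|j]]; rewrite ?phiM ?(phi_e (inl j)) ?(phi_e (inr j)).
have phi_sigma f : phi (sigma f) = (fun=> 1, f).
  have [rho [_ rho_uniq]] := F_basis H (fun j => (fun=> 1, x_ j) : wreath K F).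
  transitivity (rho f).
    have -> // : rho = phi \o sigma.
    apply: rho_uniq; split=> [a b|j] /=; rewrite ?sigmaM ?phiM //.
    by rewrite sigma_x (phi_e (inr j)).
  congr (_ f); apply: rho_uniq; split=> // a b.
  by rewrite wreathM /=; congr (_, _); apply/funext => h; rewrite mulg1.
exists (fun u => (phi u).1 1); split=> [a b Aa Ab|f j].
  by rewrite phiM wreathM /= phi2 Aa mulg1.
have : letter f j * sigma f = sigma f * alpha j.
  by rewrite /letter conjgE invgK !mulgA mulgVK.
move=> /(congr1 (fun u => (phi u).1 1)); rewrite !phiM !wreathM /= phi_sigma /= mulg1.
by move=> ->; rewrite (phi_e (inl j)) /= !mul1g.
Qed.

Definition kill (T : pred (F * 'I_g)) : pi -> pi :=
  sval (cid (letter_free (fun f j => if T (f, j) then 1 else letter f j))).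

Lemma killM T : mult_on_A (kill T).
Proof. by rewrite /kill; case: cid => k []. Qed.

Lemma kill_letter T f j : kill T (letter f j) = if T (f, j) then 1 else letter f j.
Proof. by rewrite /kill; case: cid => k []. Qed.

Lemma kill_A T a : A a -> A (kill T a).
Proof.
have [[A1 AM AV] _] := normal_A H; move=> Aa.
suff [] : [set b | A b /\ A (kill T b)] a by [].
apply: letter_ind Aa => [|f j] /=.
  split=> /= [|b c [Ab kb] [Ac kc]|b [Ab kb]].
  - by rewrite mult_on_A1 //; exact: killM.
  - by rewrite killM //; split; exact: AM.
  - by rewrite mult_on_AV //; [split; exact: AV|exact: killM].
by rewrite kill_letter; split; [exact: letterA|case: ifP => // _; exact: letterA].
Qed.

Lemma kill_conj T h a : A a ->
  kill T (a ^ (sigma h)^-1) = kill (fun t => T (h * t.1, t.2)) a ^ (sigma h)^-1.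
Proof.
have AJ u b : A b -> A (b ^ u) by case: (normal_A H) => _; apply.
apply: (letter_ext (kappa := fun b => kill T (b ^ (sigma h)^-1))
  (lambda := fun b => kill _ b ^ (sigma h)^-1)) => [b c Ab Ac|b c Ab Ac|f j].
- by rewrite conjMg killM //; exact: AJ.
- by rewrite killM // conjMg.
- by rewrite letter_conj !kill_letter /=; case: ifP; rewrite ?conj1g ?letter_conj.
Qed.

Lemma kill_comp T T' a : A a -> kill T (kill T' a) = kill (predU T' T) a.
Proof.
apply: (letter_ext (kappa := kill T \o kill T')) => [b c Ab Ac||f j] /=;
  last 1 first.
- rewrite !kill_letter /=; case: (T' _) => /=; last by rewrite kill_letter.
  by rewrite mult_on_A1 //; exact: killM.
- by rewrite !killM //; exact: kill_A.
- exact: killM.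
Qed.

Lemma kill_eq T T' a : T =1 T' -> kill T a = kill T' a.
Proof. by move=> /funext ->. Qed.

(** [S] lists the letters of a word that represents [a]. *)
Lemma kill_support a : A a -> exists S : seq (F * 'I_g),
  (forall T : pred (F * 'I_g), {in S, forall t, ~~ T t} -> kill T a = a) /\
  (forall T : pred (F * 'I_g), {in S, forall t, T t} -> kill T a = 1).
Proof.
move=> Aa; have [[A1 AM AV] _] := normal_A H.
suff [] : [set b | A b /\ exists S : seq (F * 'I_g),
  (forall T : pred (F * 'I_g), {in S, forall t, ~~ T t} -> kill T b = b) /\
  (forall T : pred (F * 'I_g), {in S, forall t, T t} -> kill T b = 1)] a by [].
apply: letter_ind Aa => [|f j] /=; last first.
  split; first exact: letterA; exists [:: (f, j)]; split=> T Tfj.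
    by rewrite kill_letter ifN // Tfj ?mem_seq1.
  by rewrite kill_letter ifT // Tfj ?mem_seq1.
split=> /= [|b c [Ab [S [S1 S2]]] [Ac [S' [S1' S2']]]|b [Ab [S [S1 S2]]]].
- by split=> //; exists [::]; split=> T _; rewrite mult_on_A1 //; exact: killM.
- split; first exact: AM.
  exists (S ++ S'); split=> T TS; rewrite killM //.
    by rewrite S1 ?S1' // => t tS; apply: TS; rewrite mem_cat tS ?orbT.
  by rewrite S2 ?S2' ?mulg1 // => t tS; apply: TS; rewrite mem_cat tS ?orbT.
- split; first exact: AV.
  exists S; split=> T TS; rewrite mult_on_AV //; try exact: killM.
    by rewrite S1.
  by rewrite S2 // invg1.
Qed.

End Letters.

(** * Independence of the 1 - x_j^-1 in the graded quotients *)

Section GradedKill.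
Variables (g : nat) (H : handlebody g).
Local Notation pi := (pi_ H).
Local Notation F := (F_ H).
Local Notation A := (@kerA g H).
Local Notation x_ := (@x_ g H).
Local Notation gr := (@gr g H).
Local Notation cls := (@cls g H).

Lemma lcs_mult_on_A (kappa : pi -> pi) : mult_on_A kappa ->
  (forall a, A a -> A (kappa a)) ->
  forall n a, lcs A n a -> lcs A n (kappa a).
Proof.
move=> kM kA; case=> [|n] //; elim: n => [|n IHn] // a.
have [[A1 AM AV] AJ] := normal_A H.
have [[L1 LM LV] LJ] := normal_lcs (normal_A H) n.+2.
suff : lcs A n.+2 `<=` [set a | A a /\ lcs A n.+2 (kappa a)] by move=> sub /sub[].
rewrite {1}lcsS; apply: commutator_set_sub => [|x y Lx Ay].
  split=> /= [|x y [Ax kx] [Ay ky]|x [Ax kx]].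
  - by rewrite (mult_on_A1 kM).
  - by rewrite kM //; split; [exact: AM|exact: LM].
  - by rewrite (mult_on_AV kM) //; split; [exact: AV|exact: LV].
have Ax : A x := lcs_subA (normal_A H) Lx.
split=> /=; first by apply: (normal_comm_r _ (normal_A H)).
have -> : kappa [~ x, y]%g = [~ kappa x, kappa y]%g.
  rewrite /commg /conjg !kM ?(mult_on_AV kM) //; repeat first [exact: AV|apply: (AM) => //].
by apply: (commutator_set_mem (H := lcs A n.+1)); [exact: IHn|exact: kA].
Qed.

Definition gr_kill (T : pred (F * 'I_g)) n (m : gr n) : gr n := cls n (kill T (rep m)).

Lemma lcs_kill T n a : lcs A n a -> lcs A n (kill T a).
Proof. by apply: lcs_mult_on_A; [exact: killM|exact: kill_A]. Qed.

Lemma gr_kill_cls T n a : lcs A n a -> gr_kill T (cls n a) = cls n (kill T a).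
Proof.
move=> La; rewrite /gr_kill; have [k Lk ->] := rep_cls La.
have Aa := lcs_subA (normal_A H) La; have Ak := lcs_subA (normal_A H) Lk.
by rewrite killM // cls_mod //; exact: lcs_kill.
Qed.

Lemma gr_killD T n : {morph @gr_kill T n : m m' / (m + m')%R}.
Proof.
move=> m m'; rewrite -[m]repK -[m']repK -clsM; [|exact: repP..].
rewrite !gr_kill_cls; [|try exact: repP..]; last first.
  by have [[_ LM _] _] := normal_lcs (normal_A H) n; apply: LM; exact: repP.
rewrite killM; try exact: lcs_subA (normal_A H) _ _ (repP _).
by rewrite clsM //; apply: lcs_kill; exact: repP.
Qed.

Lemma gr_kill_is_additive T n : zmod_morphism (@gr_kill T n).
Proof.
move=> m m'; apply: (addIr (gr_kill T m')); rewrite -gr_killD subrK.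
by rewrite -addrA addNr addr0.
Qed.

Lemma act_sigma n f a : lcs A n a ->
  (of_group f *: cls n a)%R = cls n (a ^ (sigma f)^-1)%g.
Proof.
by move=> La; rewrite [LHS]action_scaleU; apply: act_cls => //; exact: sigmaK.
Qed.

Lemma gr_kill_act T n f (m : gr n) :
  (gr_kill T (of_group f *: m) = of_group f *: gr_kill (fun t => T (f * t.1, t.2)%g) m)%R.
Proof.
have La := repP m; have [_ LJ] := normal_lcs (normal_A H) n.
rewrite -[m]repK gr_kill_cls // !act_sigma //; last exact: lcs_kill.
rewrite gr_kill_cls; last exact: LJ.
by rewrite kill_conj //; exact: lcs_subA (normal_A H) _ _ La.
Qed.

Lemma gr_kill_seq n (S : seq (F * 'I_g)) (m : gr n) :
  {in S, forall t, gr_kill (pred1 t) m = m} -> gr_kill (mem S) m = m.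
Proof.
have La := repP m; have Aa := lcs_subA (normal_A H) La.
elim: S => [|t S IHS] mS.
  rewrite -{2}[m]repK /gr_kill; congr (cls n _).
  apply: (letter_ext (kappa := kill _) (lambda := idfun)) => //; first exact: killM.
  by move=> f j; rewrite kill_letter.
have {}IHS : gr_kill (mem S) m = m by apply: IHS => u uS; rewrite mS // inE uS orbT.
suff -> : gr_kill (mem (t :: S)) m = gr_kill (pred1 t) (gr_kill (mem S) m).
  by rewrite IHS; apply/mS/mem_head.
rewrite -{1 2}[m]repK !gr_kill_cls //; last exact: lcs_kill.
by rewrite kill_comp //; congr (cls n _); apply: kill_eq => u /=; rewrite inE orbC.
Qed.

Lemma gr_kill_support n (m : gr n) : exists S : seq (F * 'I_g),
  (forall T : pred (F * 'I_g), {in S, forall t, ~~ T t} -> gr_kill T m = m) /\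
  (forall T : pred (F * 'I_g), {in S, forall t, T t} -> gr_kill T m = 0%R).
Proof.
have Aa := lcs_subA (normal_A H) (repP m).
have [S [S1 S2]] := kill_support Aa; exists S; split=> T TS.
  by rewrite /gr_kill S1 // repK.
by rewrite /gr_kill S2 //; apply: cls_eq0; case: (normal_lcs (normal_A H) n.+1) => [[]].
Qed.

Local Open Scope ring_scope.

(** With [r i m] the difference between [m] and its image when [alpha_i] is
    killed, the functions [h |-> r i (h^-1 m)] have finite support, depend
    equivariantly on [m], and vanish for all [i] only if killing any single
    letter fixes [m], that is only if [m = 0]. This reduces the claim to
    functions with finite support on [F]. *)
Lemma gr_indep n (m : 'I_g -> gr n) :
  \sum_j (1 - of_group (x_ j)^-1%g) *: m j = 0 -> forall j, m j = 0.
Proof.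
move=> sum_m.
have kB T k := gr_kill_is_additive T (n := k).
pose r i (v : gr n) := v - gr_kill (pred1 (1%g, i)) v.
have rB i : zmod_morphism (r i).
  by move=> v w; rewrite /r kB !opprB [gr_kill _ w - _]addrC addrACA [- w + _]addrC.
suff rm j i h : r i (of_group h^-1%g *: m j) = 0.
  move=> j; have [S [_ S2]] := gr_kill_support (m j).
  rewrite -[LHS](@gr_kill_seq n S) ?S2 // => -[h i] _.
  have /eqP := rm j i h; rewrite subr_eq0 => /eqP /(congr1 (fun v => of_group h *: v)).
  rewrite gr_kill_act !scalerA [_ * _]of_group_mul mulgV scale1r => {2}->.
  rewrite scale1r; congr (cls n _); apply: kill_eq => -[h' i'] /=.
  by rewrite !xpair_eqE -{1}(mulVg h) (inj_eq (mulgI _)).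
pose u j h := r i (of_group h^-1%g *: m j).
apply: (free_basis_indep (u := u) (F_basis H)) => [|h0].
  have /boolp.choice[S mS] : forall k, exists S : seq (F * 'I_g),
      forall T : pred (F * 'I_g), {in S, forall t, ~~ T t} -> gr_kill T (m k) = m k.
    by move=> k; have [S []] := gr_kill_support (m k); exists S.
  exists (flatten [seq unzip1 (S k) | k <- enum 'I_g]) => k h0 hS.
  rewrite /u /r gr_kill_act mS ?subrr // => -[h' i'] tS /=.
  rewrite xpair_eqE; apply: contra hS => /andP[/eqP h0h' _].
  have -> : h0 = h' by apply: (mulgI h0^-1%g); rewrite h0h' mulVg.
  apply/flattenP; exists (unzip1 (S k)); first by apply: map_f; rewrite mem_enum.
  by apply/mapP; exists (h', i').
pose ri := GRing.isZmodMorphism.Build _ _ (r i) (rB i).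
pose rr : {additive gr n -> gr n} := HB.pack (r i) ri.
have -> : \sum_k (u k h0 - u k (x_ k * h0)%g)
    = rr (of_group h0^-1%g *: \sum_k (1 - of_group (x_ k)^-1%g) *: m k).
  rewrite scaler_sumr raddf_sum; apply: eq_bigr => k _.
  rewrite /u scalerA mulrBr mulr1 [_ * _]of_group_mul -invgM scalerBl.
  exact: esym (raddfB rr _ _).
by rewrite sum_m scaler0 raddf0.
Qed.

End GradedKill.

(** * Derivations and the class of the boundary *)

Section GradedClasses.
Variables (g : nat) (H : handlebody g).
Local Notation pi := (pi_ H).
Local Notation F := (F_ H).
Local Notation alpha := (@alpha g H).
Local Notation beta := (@beta g H).
Local Notation varpi := (@varpi g H).
Local Notation A := (@kerA g H).
Local Notation x_ := (@x_ g H).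
Local Notation gr := (@gr g H).
Local Notation cls := (@cls g H).
Local Notation lie := (@lie g H _ _).
Local Open Scope ring_scope.

Lemma lcsM n x y : lcs A n x -> lcs A n y -> lcs A n (x * y)%g.
Proof. by case: (normal_lcs (normal_A H) n) => [[_ + _] _]; apply. Qed.

Lemma lcsV n x : lcs A n x -> lcs A n x^-1%g.
Proof. by case: (normal_lcs (normal_A H) n) => [[_ _ +] _]; apply. Qed.

Lemma lcsJ n x y : lcs A n x -> lcs A n (x ^ y)%g.
Proof. by case: (normal_lcs (normal_A H) n) => _; apply. Qed.

Lemma lcs1 n : lcs A n 1%g.
Proof. by case: (normal_lcs (normal_A H) n) => [[]]. Qed.

Lemma lcsR i j x y : lcs A i x -> lcs A j y -> lcs A (i + j) [~ x, y]%g.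
Proof. exact: lcs_comm (normal_A H) _ _ _ _. Qed.

Lemma lcs_le n n' x : (n <= n')%N -> lcs A n' x -> lcs A n x.
Proof.
move=> /subnK <-; elim: (n' - n)%N => // k IHk; rewrite addSn => /(lcs_sub (normal_A H)).
exact: IHk.
Qed.

Lemma cls1 n : cls n 1%g = 0.
Proof. by apply: cls_eq0; exact: lcs1. Qed.

Lemma clsV n x : lcs A n x -> cls n x^-1%g = - cls n x.
Proof.
move=> Lx; apply: (addrI (cls n x)); rewrite -clsM ?subrr ?mulgV ?cls1 //.
exact: lcsV.
Qed.

Lemma gr_cast_cls p q (e : p = q) x : gr_cast e (cls p x) = cls q x.
Proof. by case: _ / e. Qed.

Lemma act_clsE n x a : lcs A n a ->
  of_group (varpi x) *: cls n a = cls n (x * a * x^-1)%g.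
Proof.
move=> La; rewrite [LHS]action_scaleU (act_cls La (erefl _)).
by rewrite conjgE invgK mulgA.
Qed.

Lemma lie_anti i j (a : gr i) (b : gr j) : gr_cast (addnC i j) (lie a b) = - lie b a.
Proof.
rewrite /Defs.lie gr_cast_cls -invgR clsV //; exact: lcsR (repP _) (repP _).
Qed.

Lemma cocycle1 (M : lmodType (group_ring F)) (c : F -> M) : cocycle c -> c 1%g = 0.
Proof.
move=> cM; apply: (addrI (c 1%g)).
by rewrite addr0 -{3}(mulg1 1%g) cM scale1r.
Qed.

Lemma cocycleV (M : lmodType (group_ring F)) (c : F -> M) f : cocycle c ->
  c f^-1%g = - (of_group f^-1%g *: c f).
Proof. by move=> cM; apply/eqP; rewrite -addr_eq0 -cM mulVg cocycle1. Qed.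

Lemma derivation_zeta m d0 (dp : forall i, gr i -> gr (m + i)) :
  derivation d0 dp -> dp 1%N (cls 1 (zeta H))
  = \sum_i ((1 - of_group (x_ i)^-1%g) *: dp 1%N (cls 1 (alpha i))
            + of_group (x_ i)^-1%g *: lie (d0 (x_ i)) (cls 1 (alpha i))).
Proof.
move=> [d1 d2 d3 d4].
have d20 i : dp i 0 = 0 by apply: (addrI (dp i 0)); rewrite -d2 !addr0.
rewrite cls_zeta (big_morph (dp 1%N) (d2 1%N) (d20 1%N)); apply: eq_bigr => i _.
rewrite !scalerBl !scale1r; set a := cls 1 (alpha i).
have -> : dp 1%N (a - of_group (x_ i)^-1%g *: a)
    = dp 1%N a - dp 1%N (of_group (x_ i)^-1%g *: a).
  by apply: (addIr (dp 1%N (of_group (x_ i)^-1%g *: a))); rewrite -d2 !subrK.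
by rewrite d4 (cocycleV _ d1) lieNl lie_act opprD opprK addrA.
Qed.

End GradedClasses.

(** * The derivation induced by an endomorphism close to the identity *)

Section DerivationOfEndomorphism.
Variables (g : nat) (H : handlebody g).
Local Notation pi := (pi_ H).
Local Notation F := (F_ H).
Local Notation alpha := (@alpha g H).
Local Notation beta := (@beta g H).
Local Notation varpi := (@varpi g H).
Local Notation A := (@kerA g H).
Local Notation x_ := (@x_ g H).
Local Notation gr := (@gr g H).
Local Notation cls := (@cls g H).
Local Notation lie := (@lie g H _ _).

Variables (m : nat) (phi : pi -> pi).
Hypothesis phiM : {morph phi : x y / (x * y)%g}.

Definition deviation x : pi := (phi x * x^-1)%g.
Local Notation delta := deviation.

Hypothesis m_gt0 : (0 < m)%N.
Hypothesis delta_beta : forall i, lcs A m (delta (beta i)).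
Hypothesis delta_alpha : forall i, lcs A m.+1 (delta (alpha i)).

Lemma deviationK x : phi x = (delta x * x)%g.
Proof. by rewrite /deviation mulgVK. Qed.

Lemma deviationM x y : delta (x * y)%g = (delta x * delta y ^ x^-1)%g.
Proof. by rewrite /deviation phiM conjgE invgM invgK !mulgA mulgVK. Qed.

Lemma deviationV x : delta x^-1%g = ((delta x)^-1 ^ x)%g.
Proof.
by rewrite /deviation (morph_groupV phiM) conjgE !invgM !invgK !mulgA mulVg mul1g.
Qed.

Lemma deviationJ x a : delta (a ^ x^-1)%g
  = ((delta a ^ x^-1) ^ (delta x)^-1 * [~ (delta x)^-1, (a ^ x^-1)^-1])%g.
Proof.
by rewrite /deviation /commg !conjgE !invgK !phiM (morph_groupV phiM) !gnorm.
Qed.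

(** Expansion of [[u x, v y] [x, y]^-1] with [u] and [v] the deviations of [x] and
    [y]. The factor with [[u, v]] has higher degree than the other two, which
    are the two terms of the Leibniz rule. *)
Lemma deviationR x y : delta [~ x, y]%g
  = ([~ delta x, y] ^ x
     * (([~ delta x, delta y] ^ x * [~ x, delta y]) ^ y) ^ [~ x, y]^-1)%g.
Proof.
rewrite {1}/deviation.
have -> : phi [~ x, y]%g = [~ delta x * x, delta y * y]%g.
  by rewrite -!deviationK /commg /conjg !phiM !(morph_groupV phiM).
by rewrite /commg !conjgE !gnorm.
Qed.

Lemma subgroup_deviation (L : set pi) : normal_set L ->
  subgroup_set [set x | L (delta x)].
Proof.
move=> [[L1 LM LV] LJ].
have delta1 : delta 1%g = 1%g by rewrite /deviation (morph_group1 phiM) mulgV.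
split=> /= [|x y Lx Ly|x Lx]; rewrite ?delta1 ?deviationM ?deviationV //.
  by apply: LM => //; exact: LJ.
by apply/LJ/LV.
Qed.

Lemma deviation_lcs0 x : lcs A m (delta x).
Proof.
apply: (free_basis_ind (subgroup_deviation (normal_lcs (normal_A H) m)) (pi_basis H)).
by case=> i //=; apply: (lcs_le (leqnSn m)).
Qed.

Lemma deviation_A x : A x -> lcs A m.+1 (delta x).
Proof.
move: x; apply: (letter_ind (P := [set x | lcs A m.+1 (delta x)])).
  exact/subgroup_deviation/(normal_lcs (normal_A H)).
move=> f j /=; rewrite /letter deviationJ; apply: lcsM.
  by do 2!apply: lcsJ; exact: delta_alpha.
rewrite -addn1; apply: lcsR; first exact/lcsV/deviation_lcs0.
by apply: (lcsV (n := 1)); exact: letterA.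
Qed.

Lemma cls_mulJ n u v x y : lcs A n u -> lcs A n v -> A x -> A y ->
  (lcs A n (u ^ x * v ^ y) /\ cls n (u ^ x * v ^ y) = cls n u + cls n v)%g%R.
Proof.
move=> Lu Lv Ax Ay; split; first by apply: lcsM; exact: lcsJ.
by rewrite clsM ?cls_conjA //; exact: lcsJ.
Qed.

Lemma deviationR_cls i j x y : lcs A i x -> lcs A j y ->
  lcs A (m + i) (delta x) -> lcs A (m + j) (delta y) ->
  lcs A (m + (i + j)) (delta [~ x, y]%g) /\
  cls (m + (i + j)) (delta [~ x, y]%g)
  = (cls (m + (i + j)) [~ delta x, y]%g + cls (m + (i + j)) [~ x, delta y]%g)%R.
Proof.
move=> Lx Ly Ldx Ldy; have subA n u : lcs A n u -> A u := @lcs_subA _ _ (normal_A H) n u.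
have L1 : lcs A (m + (i + j)) [~ delta x, y]%g by rewrite addnA; exact: lcsR.
have L2 : lcs A (m + (i + j)) [~ x, delta y]%g by rewrite addnCA; exact: lcsR.
have L3 : lcs A (m + (i + j)).+1 [~ delta x, delta y]%g.
  apply: lcs_le (lcsR Ldx Ldy).
  by rewrite addnACA -[X in (X <= _)%N]add1n addnA leq_add2r -add1n leq_add2r.
have L4 : lcs A (m + (i + j)) ([~ delta x, delta y] ^ x * [~ x, delta y])%g.
  by apply: lcsM => //; apply: lcsJ; exact: lcs_le (leqnSn _) L3.
rewrite deviationR -conjgM.
have [|? ->] := cls_mulJ L1 L4 (subA _ _ Lx) (_ : A (y * [~ x, y]^-1)%g).
  exact: (lcsM (n := 1)) (subA _ _ Ly) (lcsV (n := 1) (subA _ _ (lcsR Lx Ly))).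
split=> //; rewrite (clsM (lcsJ x (lcs_le (leqnSn _) L3)) L2).
by rewrite (cls_eq0 (lcsJ x L3)) add0r.
Qed.

(** Induction on [n], each step being the Leibniz rule for a commutator of an
    element of the previous term with one of [A]. *)
Lemma deviation_lcs n x : lcs A n x -> lcs A (m + n) (delta x).
Proof.
case: n => [Ax|n]; first by rewrite addn0; exact: deviation_lcs0.
elim: n x => [|n IHn] x; first by rewrite addn1; exact: deviation_A.
suff : lcs A n.+2 `<=` [set x | lcs A (m + n.+2) (delta x)] by apply.
rewrite {1}lcsS; apply: commutator_set_sub => [|u v Lu Av].
  exact/subgroup_deviation/(normal_lcs (normal_A H)).
have [] := deviationR_cls Lu (Av : lcs A 1 v) (IHn _ Lu).
  by rewrite addn1; exact: deviation_A.
by rewrite addn1.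
Qed.

Local Open Scope ring_scope.

Definition endo_der i (a : gr i) : gr (m + i) := cls (m + i) (delta (rep a)).

Lemma endo_der_cls i x : lcs A i x -> endo_der (cls i x) = cls (m + i) (delta x).
Proof.
move=> Lx; rewrite /endo_der; have [k Lk ->] := rep_cls Lx.
rewrite deviationM cls_mod //; first exact: deviation_lcs.
by apply: lcsJ; rewrite -addnS; exact: deviation_lcs.
Qed.

Lemma endo_derP (c : F -> gr m) : cocycle c ->
  (forall i, cls m (delta (beta i)) = c (x_ i)) -> derivation c endo_der.
Proof.
move=> cM c_beta.
have c1 := cocycle1 cM.
have subA n u : lcs A n u -> A u := @lcs_subA _ _ (normal_A H) n u.
have clsJ n x u : lcs A n u -> cls n (u ^ x^-1)%g = of_group (varpi x) *: cls n u.
  by move=> Lu; rewrite act_clsE // conjgE invgK mulgA.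
(* Both sides are cocycles on pi that agree on its basis. *)
have c_delta x : c (varpi x) = cls m (delta x).
  apply: (free_basis_ind (P := [set x | c (varpi x) = cls m (delta x)]) _ (pi_basis H)).
    have cdM y z : c (varpi y) = cls m (delta y) -> c (varpi z) = cls m (delta z) ->
        c (varpi (y * z)%g) = cls m (delta (y * z)%g).
      move=> cy cz; rewrite varpiM cM cy cz deviationM clsM ?clsJ //; try exact: deviation_lcs0.
      exact/lcsJ/deviation_lcs0.
    have cd1 : c (varpi 1%g) = cls m (delta 1%g).
      rewrite varpi1 c1 cls_eq0 //; apply: deviation_A.
      by case: (normal_A H) => [[]].
    split=> //= y cy.
    rewrite deviationV -[X in (_ ^ X)%g]invgK clsJ; last exact/lcsV/deviation_lcs0.
    rewrite clsV; last exact: deviation_lcs0.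
    by rewrite -cy varpiV scalerN cocycleV.
  case=> i /=; last by rewrite c_beta.
  by rewrite (alphaA H i) c1 cls_eq0.
split=> // [i a b|i j a b|i f b].
- rewrite -[a]repK -[b]repK; move: (repP a) (repP b).
  move: (rep a) (rep b) => u v Lu Lv.
  rewrite -clsM // !endo_der_cls //; last exact: lcsM.
  rewrite deviationM clsM; try exact/deviation_lcs; last exact/lcsJ/deviation_lcs.
  rewrite cls_conjA //; first exact: deviation_lcs.
  exact: (lcsV (n := 1) (subA _ _ Lu)).
- rewrite -[a]repK -[b]repK; move: (repP a) (repP b).
  move: (rep a) (rep b) => u v Lu Lv.
  have Ldu := deviation_lcs Lu; have Ldv := deviation_lcs Lv.
  rewrite lie_cls // !endo_der_cls ?lie_cls ?gr_cast_cls //; last exact: lcsR.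
  by case: (deviationR_cls Lu Lv Ldu Ldv).
- rewrite -[b]repK -[f]sigmaK; move: (repP b) (sigma f).
  move: (rep b) => v Lv x; rewrite c_delta -clsJ // !endo_der_cls //; last exact: lcsJ.
  have Lvx : lcs A i (v ^ x^-1)%g by exact: lcsJ.
  have Lx := deviation_lcs0 x; have Ldv := deviation_lcs Lv.
  rewrite deviationJ clsM; last by apply: lcsR; exact: lcsV.
    rewrite -lie_cls ?clsV ?lieNl ?lieNr ?opprK //; try exact: lcsV.
    rewrite cls_conjA ?clsJ //; first exact: lcsJ.
    exact: (lcsV (n := 1) (subA _ _ Lx)).
  by do 2!apply: lcsJ.
Qed.

End DerivationOfEndomorphism.

(** * Uniqueness and existence of derivations with a given cocycle *)

Section ZetaDerivations.
Variables (g : nat) (H : handlebody g).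
Local Notation pi := (pi_ H).
Local Notation F := (F_ H).
Local Notation alpha := (@alpha g H).
Local Notation beta := (@beta g H).
Local Notation varpi := (@varpi g H).
Local Notation A := (@kerA g H).
Local Notation x_ := (@x_ g H).
Local Notation gr := (@gr g H).
Local Notation cls := (@cls g H).
Local Notation lie := (@lie g H _ _).
Local Open Scope ring_scope.

Lemma dp_cast m (dp : forall i, gr i -> gr (m + i)) p q (e : p = q) a :
  dp q (gr_cast e a) = gr_cast (congr1 (addn m) e) (dp p a).
Proof. by case: _ / e. Qed.

(** Such a [d] is linear over [Z[F]], so it vanishes on the [a_i] by independence
    of the [1 - x_i^-1], and the [a_i] generate the graded Lie algebra together
    with the action of [F]. *)
Lemma der_zeta_eq0 m (d : der_zeta H m) : der0 d =1 (fun=> 0) -> d = 0.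
Proof.
move=> d0; have dP := der_zetaP d; case: (dP) => [d1 d2 d3 d4].
have subA n u : lcs A n u -> A u := @lcs_subA _ _ (normal_A H) n u.
have d20 i : @derp _ _ _ d i 0 = 0 by apply: (addrI (derp d 0)); rewrite -d2 !addr0.
have d2N i a : @derp _ _ _ d i (- a) = - derp d a.
  by apply: (addrI (derp d a)); rewrite -d2 !subrr d20.
have d_alpha : forall i, derp d (cls 1 (alpha i)) = 0.
  apply: gr_indep; rewrite -[RHS](der_zeta0 d) (derivation_zeta dP).
  by apply: eq_bigr => i _; rewrite d0 lie0l scaler0 addr0.
have vanish n (P : set pi) : subgroup_set P -> P `<=` lcs A n ->
    subgroup_set [set u | P u /\ derp d (cls n u) = 0].
  move=> [P1 PM PV] PL; split=> /= [|u v [Pu du] [Pv dv]|u [Pu du]].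
  - by rewrite cls1.
  - by split; [exact: PM|rewrite (clsM (PL _ Pu) (PL _ Pv)) d2 du dv addr0].
  - by split; [exact: PV|rewrite (clsV (PL _ Pu)) d2N du oppr0].
have sA n : subgroup_set (lcs A n) by case: (normal_lcs (normal_A H) n).
have d_gr1 (a : gr 1) : derp d a = 0.
  rewrite -[a]repK; have := repP a; move: (rep a) => u Au.
  suff [] : [set u | lcs A 1 u /\ derp d (cls 1 u) = 0] u by [].
  apply: letter_ind Au => [|f j] /=; first exact: vanish.
  split; first exact: letterA.
  by rewrite -act_sigma ?d4 ?d_alpha ?d0 ?lie0l ?scaler0 ?addr0 //; exact: alphaA.
have d_gr n (a : gr n) : derp d a = 0.
  case: n a => [|n] a; first by rewrite (gr0 a).
  elim: n a => [|n IHn] a; first exact: d_gr1.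
  rewrite -[a]repK; have := repP a; move: (rep a) => u Lu.
  suff [] : [set u | lcs A n.+2 u /\ derp d (cls n.+2 u) = 0] u by [].
  move: u Lu; rewrite {1}lcsS; apply: commutator_set_sub; first exact: vanish.
  move=> u v Lu Av; have Lv : lcs A 1 v by [].
  have Luv : lcs A n.+2 [~ u, v]%g by rewrite -addn1; exact: lcsR.
  split=> //=; rewrite -(gr_cast_cls (addn1 n.+1)) dp_cast -lie_cls //.
  by rewrite d3 IHn d_gr1 lie0l lie0r !gr_cast0 addr0 gr_cast0.
by apply: der_zeta_ext => [f|n a] /=; [exact: d0|exact: d_gr].
Qed.

Lemma der_zeta_exists m (c : F -> gr m) (z : 'I_g -> gr (m + 1)) :
  (0 < m)%N -> cocycle c ->
  \sum_i lie (c (x_ i)) (cls 1 (alpha i))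
    = \sum_i (1 - of_group (x_ i)^-1%g) *: z i ->
  exists d : der_zeta H m, der0 d = c.
Proof.
move=> m_gt0 cM sum_c.
pose L i := lie (c (x_ i)) (cls 1 (alpha i)).
(* sum_i (1 - x_i^-1) y_i + x_i^-1 L_i = sum_i L_i - (1 - x_i^-1) z_i = 0 *)
pose y i := L i - z i.
have [phi [[phiM phi_e] _]] := pi_basis H (fun s : 'I_g + 'I_g =>
  match s with inl i => rep (y i) * alpha i | inr i => rep (c (x_ i)) * beta i end)%g.
have delta_alpha i : deviation phi (alpha i) = rep (y i).
  by rewrite /deviation (phi_e (inl i)) mulgK.
have delta_beta i : deviation phi (beta i) = rep (c (x_ i)).
  by rewrite /deviation (phi_e (inr i)) mulgK.
have L_alpha i : lcs A m.+1 (deviation phi (alpha i)).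
  by rewrite delta_alpha -addn1; exact: repP.
have L_beta i : lcs A m (deviation phi (beta i)) by rewrite delta_beta; exact: repP.
have dP : derivation c (endo_der m phi).
  by apply: endo_derP => // i; rewrite delta_beta repK.
suff dz : endo_der m phi (cls 1 (zeta H)) = 0 by exists (DerZeta dP dz).
rewrite (derivation_zeta dP).
have e_alpha i : endo_der m phi (cls 1 (alpha i)) = y i.
  by rewrite endo_der_cls ?delta_alpha ?repK //; exact: alphaA.
rewrite (eq_bigr (fun i => L i - (1 - of_group (x_ i)^-1%g) *: z i)).
  by rewrite sumrB sum_c subrr.
move=> i _; rewrite e_alpha /y -/(L i) scalerBr scalerBl scale1r.
by rewrite [LHS]addrAC subrK.
Qed.

End ZetaDerivations.

(** * Coinvariants and the equation defining the target *)

Section Coinvariants.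
Variables (g : nat) (H : handlebody g).
Local Notation pi := (pi_ H).
Local Notation F := (F_ H).
Local Notation alpha := (@alpha g H).
Local Notation A := (@kerA g H).
Local Notation x_ := (@x_ g H).
Local Notation gr := (@gr g H).
Local Notation cls := (@cls g H).
Local Notation lie := (@lie g H _ _).
Local Open Scope ring_scope.

(** The right ideal generated by the [1 - x_i^-1] contains [f - 1] for every [f],
    by induction on [f] along the identity [f h - 1 = (f - 1) h + (h - 1)]. *)
Lemma augmentation_ideal_gen (s : group_ring F) : augmentation s = 0 ->
  exists t : 'I_g -> group_ring F, s = \sum_i (1 - of_group (x_ i)^-1%g) * t i.
Proof.
pose J : set (group_ring F) :=
  [set s | exists t : 'I_g -> group_ring F, s = \sum_i (1 - of_group (x_ i)^-1%g) * t i].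
have J0 : J 0 by exists (fun=> 0); rewrite big1 // => i _; rewrite mulr0.
have JB u v : J u -> J v -> J (u - v).
  move=> [t ->] [t' ->]; exists (fun i => t i - t' i).
  by rewrite -sumrB; apply: eq_bigr => i _; rewrite mulrBr.
have JN u : J u -> J (- u) by move=> Ju; rewrite -sub0r; exact: JB.
have JM u v : J u -> J (u * v).
  move=> [t ->]; exists (fun i => t i * v).
  by rewrite mulr_suml; apply: eq_bigr => i _; rewrite mulrA.
have ofM (f h : F) : of_group (f * h)%g = of_group f * of_group h.
  by rewrite [RHS]of_group_mul.
have ofV (f : F) : of_group f^-1%g * of_group f = 1 by rewrite -ofM mulVg.
have Vof (f : F) : of_group f * of_group f^-1%g = 1 by rewrite -ofM mulgV.
have JF (f : F) : J (of_group f - 1).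
  apply: (free_basis_ind (P := [set f | J (of_group f - 1)]) _ (F_basis H)) => [|i] /=.
    split=> /= [|f' h Jf Jh|f' Jf]; first by rewrite subrr.
      rewrite ofM -[_ * _ - _](subrKA (of_group h)) -[X in _ - X + _]mul1r -mulrBl.
      by rewrite -[_ + _]opprK opprD; apply/JN/JB; [exact/JN/JM|].
    rewrite -[X in _ - X](Vof f') -[X in X - _]mul1r -mulrBl -opprB mulNr.
    exact/JN/JM.
  exists (fun j => if j == i then of_group (x_ i) else 0).
  rewrite (bigD1 i) //= eqxx big1 ?addr0 => [|j /negPf ->]; last exact: mulr0.
  by rewrite mulrBl mul1r ofV.
have defect (u v : group_ring F) : u - (augmentation u)%:~R - (v - (augmentation v)%:~R)
    = u - v - (augmentation (u - v))%:~R.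
  by rewrite [augmentation (_ - _)]raddfB rmorphB !opprB [X in _ + X = _]addrC
    addrACA [X in _ = _ + X]addrC.
move=> aug_s; suff : J (s - (augmentation s)%:~R) by rewrite aug_s subr0.
elim/malg_ind: s {aug_s} => [|f|u v Ju Jv].
- by rewrite [augmentation 0]raddf0 subrr.
- by rewrite [augmentation _]zliftU; exact: JF.
- by have := JB _ _ Ju Jv; rewrite defect.
Qed.

(** The submodule [I_F gr_n], described by the generators of the augmentation
    ideal. *)
Definition in_IF n (a : gr n) :=
  exists y : 'I_g -> gr n, a = \sum_i (1 - of_group (x_ i)^-1%g) *: y i.

Lemma Abar_scale_component s (a : Abar H) n : (s *: a) n = s *: a n.
Proof.
elim/malg_ind: s => [|f|u v IHu IHv]; first by rewrite !scale0r.
  exact: Abar_scaleE.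
by rewrite !scalerBl -IHu -IHv.
Qed.

Lemma Abar_sum_component (e : 'I_g -> Abar H) n : (\sum_i e i) n = \sum_i e i n.
Proof. exact: (big_morph (fun a : Abar H => a n)). Qed.

Lemma coinv_class_sum (e : 'I_g -> Abar H) :
  coinv_class (\sum_i e i) = \sum_i coinv_class (e i).
Proof.
apply: (big_morph _ (@coinv_classD g H)).
by apply: (addrI (coinv_class 0)); rewrite -coinv_classD !addr0.
Qed.

Lemma coinv_class_eq0P (e : Abar H) : coinv_class e = 0 <-> forall n, in_IF (e n).
Proof.
split=> [e0|eI].
  have : coinv_class e == coinv_class 0.
    by rewrite e0 -[X in X == _](subrr (coinv_class 0)) -coinv_classB subr0.
  rewrite -Quotient.idealrBE subr0 => /asboolP.
  move=> /(_ [set e : Abar H | forall n, in_IF (e n)]); apply.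
  split=> [|_ [s s0 [a _ <-]] n].
    split=> [n|u v uI vI n] /=.
      by exists (fun=> 0); rewrite big1 // => i _; rewrite scaler0.
    have [y ->] := uI n; have [y' ->] := vI n; exists (fun i => y i - y' i).
    by rewrite -sumrB; apply: eq_bigr => i _; rewrite scalerBr.
  have [t ->] := augmentation_ideal_gen s0.
  exists (fun i => t i *: a n); rewrite Abar_scale_component scaler_suml.
  by apply: eq_bigr => i _; rewrite scalerA.
have [N eN] := componentP e.
pose y n := sval (cid (eI n)).
have yP n : e n = \sum_i (1 - of_group (x_ i)^-1%g) *: y n i := svalP (cid (eI n)).
have YP i : finitely_supported (fun n => if (n < N)%N then y n i else 0).
  by exists N => n; rewrite leqNgt => /negPf ->.
pose Y i : Abar H := DirectSum (YP i).
have -> : e = \sum_i (1 - of_group (x_ i)^-1%g) *: Y i.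
  apply: direct_sum_ext => n; rewrite Abar_sum_component.
  under eq_bigr do rewrite Abar_scale_component /=.
  have [nN|/eN ->] := ltnP n N; first exact: yP.
  by rewrite big1 // => i _; rewrite scaler0.
rewrite coinv_class_sum big1 // => i _; apply: coinv_class_eq.
by rewrite [augmentation _]raddfB /= [X in X - _]zliftU [X in _ - X]zliftU subrr.
Qed.

Lemma Abar_lie1 (a : gr 1) (b : Abar H) k :
  Abar_lie (Abar1 a) b k.+1 = lie a (b k) :> gr (1 + k).
Proof.
rewrite /= (bigD1 (@Ordinal k.+2 1 isT)) //= [X in _ + X]big1 ?addr0; last first.
  by case=> -[|[|i]] // iP _ /=; rewrite lie0l gr_cast0.
by rewrite /Defs.lie gr_cast_cls /= subn1.
Qed.

Lemma gr_cast_sum p q (e : p = q) (y : 'I_g -> gr p) :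
  gr_cast e (\sum_i y i) = \sum_i gr_cast e (y i).
Proof. by case: _ / e. Qed.

(** By antisymmetry of the bracket, the sum on the right is the element of degree
    [k + 1] whose class is the corresponding component of [beta theta(c)]. *)
Lemma bracket_theta0P (c : F -> Abar H) : bracket_map (theta c) = 0 <->
  forall k, in_IF (\sum_i lie (c (x_ i) k) (cls 1 (alpha i))).
Proof.
have bM : zmod_morphism (@bracket_map g H) := @bracket_map_is_additive g H.
pose bi := GRing.isZmodMorphism.Build _ _ (@bracket_map g H) bM.
pose b : {additive tensor (@ract g H) (Abar H) -> Abar_coinv H} :=
  HB.pack (@bracket_map g H) bi.
have -> : bracket_map (theta c)
    = - coinv_class (\sum_i Abar_lie (Abar1 (cls 1 (alpha i))) (c (x_ i))).
  rewrite -[LHS]/(b _) (raddfN b) (raddf_sum b) coinv_class_sum; apply: (congr1 -%R).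
  by apply: eq_bigr => i _; exact: bracket_map_tens.
rewrite (rwP eqP) oppr_eq0 -(rwP eqP) coinv_class_eq0P.
have cast_IF p q (e : p = q) (a : gr p) : in_IF a -> in_IF (- gr_cast e a).
  move=> [y ->]; exists (fun i => - gr_cast e (y i)).
  rewrite gr_cast_sum -sumrN; apply: eq_bigr => i _.
  by rewrite gr_castZ scalerN.
split=> cI k.
  have := cast_IF _ _ (addnC 1 k) _ (cI k.+1); congr in_IF.
  rewrite Abar_sum_component; under eq_bigr do rewrite Abar_lie1.
  by rewrite gr_cast_sum -sumrN; apply: eq_bigr => i _; rewrite lie_anti opprK.
case: k => [|k]; first by exists (fun=> 0); exact: etrans (gr0 _) (esym (gr0 _)).
have := cast_IF _ _ (addnC k 1) _ (cI k); congr in_IF.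
rewrite Abar_sum_component; under [in RHS]eq_bigr do rewrite Abar_lie1.
by rewrite gr_cast_sum -sumrN; apply: eq_bigr => i _; rewrite lie_anti opprK.
Qed.

End Coinvariants.

(** * The isomorphism *)

Local Open Scope ring_scope.

Theorem proposition8p2 (g : nat) (g_gt0 : (0 < g)%N) (H : handlebody g) :
  {morph @der_restr g H : d e / d + e} /\
  set_bij setT (@D_plus0 g H) (@der_restr g H).
Proof.
have restrD : {morph @der_restr g H : d e / d + e}.
  move=> d e; apply/funext => f; apply: direct_sum_ext => -[|k] //=.
  by rewrite addr0.
split=> //; split=> [d _|d e _ _ de|c [cM /bracket_theta0P cI]].
- split=> [f h|].
    apply: direct_sum_ext => -[|k] /=; first by exact: etrans (gr0 _) (esym (gr0 _)).
    rewrite Abar_scaleE /=; have [d1 _ _ _] := der_zetaP (d k); exact: d1.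
  apply/bracket_theta0P => -[|k] /=.
    by exists (fun=> 0); rewrite !big1 // => i _; rewrite ?scaler0 ?lie0l.
  pose L i := lie (der0 (d k) (@x_ g H i)) (@cls g H 1 (@alpha g H i)).
  have := der_zeta0 (d k); rewrite (derivation_zeta (der_zetaP (d k))).
  rewrite (eq_bigr (fun i => (1 - of_group (@x_ g H i)^-1%g)
    *: (derp (d k) (@cls g H 1 (@alpha g H i)) - L i) + L i)); last first.
    move=> i _; rewrite -/(L i) scalerBr -addrA; congr (_ + _).
    by rewrite scalerBl scale1r opprB subrK.
  rewrite big_split /= => /eqP; rewrite addrC addr_eq0 => /eqP ->.
  exists (fun i => - (derp (d k) (@cls g H 1 (@alpha g H i)) - L i)).
  by rewrite -sumrN; apply: eq_bigr => i _; rewrite scalerN.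
- apply: direct_sum_ext => k; apply/eqP; rewrite -subr_eq0; apply/eqP.
  apply: der_zeta_eq0 => f /=.
  have /(congr1 (fun a : Abar H => a k.+1)) /= -> := congr1 (fun r => r f) de.
  exact: subrr.
- have ck_M k : cocycle (fun f => c f k.+1) by move=> f h; rewrite cM /= Abar_scaleE.
  have ex_d k : exists d : der_zeta H k.+1, der0 d = fun f => c f k.+1.
    have [y ye] := cI k.+1; exact: der_zeta_exists (ck_M k) ye.
  pose d k := sval (cid (ex_d k)).
  have dE k f : der0 (d k) f = c f k.+1 by rewrite (svalP (cid (ex_d k))).
  have dP : finitely_supported d.
    have /boolp.choice[N cN] : forall i, exists N, forall n, (N <= n)%N -> c (@x_ g H i) n = 0.
      by move=> i; exact: (componentP (c (@x_ g H i))).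
    exists (\max_i N i)%N => k Nk; apply: der_zeta_eq0 => f; rewrite dE.
    (* A cocycle that vanishes on the basis is zero. *)
    apply: (free_basis_ind (P := [set f | c f k.+1 = 0]) _ (F_basis H)) => [|i] /=.
      have c1 := cocycle1 (ck_M k).
      split=> /= [//|f' h cf ch|f' cf]; first by rewrite ck_M cf ch scaler0 addr0.
      by have := ck_M k f'^-1%g f'; rewrite mulVg c1 cf scaler0 addr0 => <-.
    by apply: (cN i); apply: leq_trans (leq_trans Nk (leqnSn k)); exact: leq_bigmax.
  exists (DirectSum dP : Der_plus_zeta H) => //; apply/funext => f.
  by apply: direct_sum_ext => -[|k] /=; [rewrite [RHS]gr0|exact: dE].
Qed.
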